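(* Let $X$ be a complex affine variety and $f \in \mathcal{K}^0(X(\mathbb{C}))\setminus \mathbb{C}[X]$. Then there exists an element $g\in \mathbb{C}[X][f]\setminus \mathbb{C}[X]$ such that $g^n \in \operatorname{Cond}(f) \subset \mathbb{C}[X]$ for all integers $n\geqslant 2$.
   Context: An affine complex variety is $X=\operatorname{Spec}(\mathbb{C}[X])$ with $\mathbb{C}[X]$ a reduced finitely generated $\mathbb{C}$-algebra ($X$ need not be irreducible). $X(\mathbb{C})$ is the set of closed points of $X$, identified with a Zariski closed subset of some $\mathbb{C}^n$; elements of $\mathbb{C}[X]$ are identified with polynomial functions on $X(\mathbb{C})$. A function $f:X(\mathbb{C})\to\mathbb{C}$ is rational if it is regular on some Zariski dense Zariski open subset of $X(\mathbb{C})$. $\mathcal{K}^0(X(\mathbb{C}))$ is the ring of functions $f:X(\mathbb{C})\to\mathbb{C}$ that are rational and continuous on all of $X(\mathbb{C})$ for the Euclidean topology; it contains $\mathbb{C}[X]$. For $f\in\mathcal{K}^0(X(\mathbb{C}))$, $\mathbb{C}[X][f]$ is the subring of $\mathcal{K}^0(X(\mathbb{C}))$ generated by $\mathbb{C}[X]$ and $f$, and $$\operatorname{Cond}(f)=\{p\in\mathbb{C}[X]\mid p\cdot\mathbb{C}[X][f]\subseteq\mathbb{C}[X]\}$$ is the conductor of $\mathbb{C}[X]$ in $\mathbb{C}[X][f]$. *)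

(* Defs.v *)
From HB Require Import structures.
From mathcomp Require Import all_boot all_order all_algebra.
From mathcomp Require Import complex.
From mathcomp Require Import all_classical all_reals all_analysis.
From mathcomp Require mpoly.

Set Implicit Arguments.
Unset Strict Implicit.
Unset Printing Implicit Defensive.

Import Order.TTheory GRing.Theory Num.Theory.
Import numFieldNormedType.Exports.

Local Open Scope classical_set_scope.
Local Open Scope ring_scope.

(* R[i] as an abstract numClosedFieldType: MathComp-Analysis puts the norm
   topology on the carrier of such a structure, not on the bare type R[i]. *)
Definition Cplx (R : realType) : numClosedFieldType := complex R.

Section AffineVariety.
Variables (R : realType) (n : nat).

Definition cpoly := mpoly.mpoly n (Cplx R).

Definition peval (p : cpoly) (x : 'rV[Cplx R]_n) : Cplx R :=
  mpoly.meval (fun i => x ord0 i) p.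

Definition zero_locus (S : set cpoly) : set 'rV[Cplx R]_n :=
  [set x | forall p, S p -> peval p x = 0].

(* A complex affine variety is given by its closed points, a Zariski closed
   subset X of C^n.  Functions on X are functions on the subtype of X (with its
   pointwise ring structure), so that functions agreeing on X are equal; this
   subtype carries the topology induced by the Euclidean topology of C^n. *)
Definition zariski_closed (X : set 'rV[Cplx R]_n) : Prop :=
  exists S : set cpoly, X = zero_locus S.

Variable X : set 'rV[Cplx R]_n.

Definition zariski_open (U : set X) : Prop :=
  exists S : set cpoly, U = ~` [set x : X | zero_locus S (set_val x)].

Definition zariski_dense (U : set X) : Prop :=
  forall V : set X, zariski_open V -> V !=set0 -> V `&` U !=set0.

Definition coordinate_ring : set (X -> Cplx R) :=
  [set h | exists p : cpoly, forall x : X, h x = peval p (set_val x)].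

Definition regular_on (U : set X) (f : X -> Cplx R) : Prop :=
  forall x : X, U x ->
    exists (p q : cpoly) (V : set X),
      [/\ zariski_open V, V x, V `<=` U &
          forall y : X, V y -> peval q (set_val y) != 0 /\
            f y = peval p (set_val y) / peval q (set_val y)].

Definition rational (f : X -> Cplx R) : Prop :=
  exists U : set X, [/\ zariski_open U, zariski_dense U & regular_on U f].

Definition K0 : set (X -> Cplx R) := [set f | rational f /\ continuous f].

(* Since K0 is a subring of the ring of all functions on X, the subring
   generated by C[X] and f can be taken in the latter. *)
Definition adjoin (f : X -> Cplx R) : set (X -> Cplx R) :=
  smallest (fun A : set (X -> Cplx R) => GRing.subring_closed (mem A))
    (coordinate_ring `|` [set f]).

Definition conductor (f : X -> Cplx R) : set (X -> Cplx R) :=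
  [set p | coordinate_ring p /\
           forall h, adjoin f h -> coordinate_ring (p * h)].

End AffineVariety.

Arguments coordinate_ring {R n} X _.
Arguments K0 {R n} X _.

(* Main.v *)
Require Import Defs.
From HB Require Import structures.
From mathcomp Require Import all_boot all_order all_algebra generic_quotient.
From mathcomp Require Import ring lra.
From mathcomp Require Import complex.
From mathcomp Require Import all_classical all_reals all_analysis.
From mathcomp Require mpoly.
Import -(notations) mpoly.

Set Implicit Arguments.
Unset Strict Implicit.
Unset Printing Implicit Defensive.

Import Order.TTheory GRing.Theory Num.Theory.
Import numFieldNormedType.Exports.

Local Open Scope classical_set_scope.
Local Open Scope ring_scope.

(** Write A for the coordinate ring of X and B for A[f]. The whole point is that
    the conductor, an ideal of A and of B, is not a radical ideal of B when f is
    not in A. Granting this, some b in B outside A has a power in the conductor;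
    at the largest k such that b^k is not in the conductor, b^k c lies outside A
    for some c in B, and g = b^k c works, because g^m is a multiple of b^(k+1)
    as soon as m >= 2 ([square_in_conductor]).

    Continuity enters through two facts: f is integral over A
    ([integral_over_ring]), and the graph of f is Zariski closed
    ([graph_closed]). They imply that on any nonempty set Z of points f agrees
    with a fraction t/s whose denominator is not identically zero on Z
    ([rational_on_subset]). Indeed, let P(x, f(x)) = 0 be a relation on Z of
    least degree d whose leading coefficient s0 is not identically zero on Z. Up
    to powers of s0, all other relations are multiples of P at the points of Z,
    so where s0(x) <> 0 every root of P(x, T) gives a point of the closed graph
    and is equal to f(x); hence P(x, T) = s0(x) (T - f(x))^d, and the
    coefficient of T^(d-1) expresses f(x) as a fraction, the characteristic
    being 0.

    Suppose now that the conductor is radical in B and let Z be its zero set,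
    which is not empty if f is not in A. By the Nullstellensatz, applicable
    because the graph of f is the set of closed points of Spec B, an element of
    B that vanishes on Z is in the conductor. As f is integral, B is generated
    over A by finitely many powers of f, so a power of s multiplies B into A up
    to elements vanishing on Z, which are in the conductor, hence in A: this
    power of s is in the conductor and so vanishes on Z, a contradiction
    ([radical_conductor_trivial]).

    The two facts about f are proved on each irreducible component Y that meets
    the domain of f, where s f = t for some polynomials with s not identically
    zero. Let q : Y -> C^r be a finite projection (Noether normalization) and
    let k be a continuous function on Y that is rational in the same sense, with
    minimal equation F over C[z]. For generic z every root of F(z, T) is the
    value of k at a point of Y over z ([generic_lift]). These values are bounded
    when z is, by compactness, so the coefficients of F divided by the leading
    one are locally bounded rational functions on C^r, that is, polynomials
    ([bounded_quotient]): F can be taken monic. Letting a generic z tend to a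
    given point, compactness shows that every root of F(z, T) is a value of k
    over z, for all z ([lift_limit]). Applied to a linear form that separates
    the points of one fibre of q, this gives the Euclidean density in Y of the
    set s <> 0 ([dense_vanishing]), and therefore F(q(y), k(y)) = 0 on all of Y.
    With k = f this is integrality; with k a linear form in the coordinates and
    f separating the points of the graph over one fibre of q, it is the
    closedness of the graph. *)

(** * Subrings and adjunction of elements *)

Section Subrings.
Variable M : comNzRingType.
Implicit Types (S : M -> Prop) (b : M) (G H : {poly M}).

(** Subrings are predicates and not types, so that the tower obtained by adjoining
    elements one at a time stays inside one ambient ring. *)
Definition subring S :=
  [/\ S 1, forall x y, S x -> S y -> S (x - y)
    & forall x y, S x -> S y -> S (x * y)].

Lemma subring0 S : subring S -> S 0.
Proof. by case=> S1 SB _; rewrite -(subrr 1); apply: SB. Qed.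

Lemma subringN S (x : M) : subring S -> S x -> S (- x).
Proof. by move=> Ss Sx; rewrite -sub0r; case: (Ss) => _ SB _; apply: SB (subring0 Ss) Sx. Qed.

Lemma subringD S (x y : M) : subring S -> S x -> S y -> S (x + y).
Proof.
by move=> Ss Sx Sy; rewrite -[y]opprK; case: (Ss) => _ SB _; apply/SB/(subringN Ss).
Qed.

Lemma subring_sum S (I : Type) (r : seq I) (P : pred I) (F : I -> M) :
  subring S -> (forall i, P i -> S (F i)) -> S (\sum_(i <- r | P i) F i).
Proof.
move=> Ss SF; apply: (big_ind S) => //; first exact: subring0.
by move=> x y; apply: subringD.
Qed.

Lemma subring_prod S (I : Type) (r : seq I) (P : pred I) (F : I -> M) :
  subring S -> (forall i, P i -> S (F i)) -> S (\prod_(i <- r | P i) F i).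
Proof. by move=> [S1 _ SM] SF; apply: (big_ind S). Qed.

Lemma subring_exp S (x : M) k : subring S -> S x -> S (x ^+ k).
Proof.
by move=> [S1 _ SM] Sx; elim: k => [|k IHk]; rewrite ?expr0 // exprS; apply: SM.
Qed.

Definition polyin S G := forall i, S G`_i.

Lemma polyinC S (x : M) : subring S -> S x -> polyin S x%:P.
Proof. by move=> Ss Sx i; rewrite coefC; case: eqP => // _; apply: subring0. Qed.

Lemma polyinXn S k : subring S -> polyin S 'X^k.
Proof.
move=> Ss i; rewrite coefXn; case: eqP => _ //=; last exact: subring0.
by case: Ss.
Qed.

Lemma polyinB S G H : subring S -> polyin S G -> polyin S H -> polyin S (G - H).
Proof. by move=> [_ SB _] SG SH i; rewrite coefB; apply: SB. Qed.

Lemma polyinM S G H : subring S -> polyin S G -> polyin S H -> polyin S (G * H).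
Proof.
move=> Ss SG SH i; rewrite coefM; apply: subring_sum => // j _.
by case: (Ss) => _ _; apply.
Qed.

Lemma polyinZ S a G : subring S -> S a -> polyin S G -> polyin S (a *: G).
Proof. by move=> [_ _ SM] Sa SG i; rewrite coefZ; apply: SM. Qed.

Lemma polyin_subring S : subring S ->
  [/\ polyin S 1, forall G H, polyin S G -> polyin S H -> polyin S (G - H)
    & forall G H, polyin S G -> polyin S H -> polyin S (G * H)].
Proof.
move=> Ss; split; last by move=> G H; apply: polyinM.
- by apply: polyinC => //; case: Ss.
- by move=> G H; apply: polyinB.
Qed.

(** Multiplying by the leading coefficient of F at each step of the Euclidean
    division makes it possible without inverses, hence without leaving S. *)
Lemma pseudo_division S F G : subring S -> polyin S F -> polyin S G -> F != 0 ->
  exists k, exists Q R, [/\ polyin S Q, polyin S R, (size R < size F)%N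
    & lead_coef F ^+ k *: G = Q * F + R].
Proof.
move=> Ss SF; have Sl : S (lead_coef F) by apply: SF.
elim/ltn_ind: {G}(size G) {-2}G (leqnn (size G)) => n IHn G le_Gn SG F0.
have [lt_GF|le_FG] := ltnP (size G) (size F).
  exists 0%N, 0, G; rewrite expr0 scale1r mul0r add0r; split=> //.
  by move=> i; rewrite coef0; apply: subring0.
have sF : (0 < size F)%N by rewrite size_poly_gt0.
have sG : (0 < size G)%N := leq_trans sF le_FG.
pose U := lead_coef G *: 'X^(size G - size F) : {poly M}.
have SU : polyin S U by apply: polyinZ => //; [exact: SG | exact: polyinXn].
pose G1 := lead_coef F *: G - U * F.
have SG1 : polyin S G1 by apply: polyinB; rewrite //; [apply: polyinZ | apply: polyinM].
have lt_G1 : (size G1 < size G)%N.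
  rewrite -(prednK sG) ltnS; apply/leq_sizeP => i; rewrite leq_eqVlt => /orP[/eqP<-|].
    rewrite coefB coefZ -lead_coefE -scalerAl coefZ coefXnM.
    have -> : (size G).-1 = ((size G - size F) + (size F).-1)%N.
      by move: le_FG; rewrite -(prednK sF) -(prednK sG) /= ltnS subSS => /subnK.
    by rewrite ltnNge leq_addr /= addKn -lead_coefE mulrC subrr.
  rewrite prednK // => le_i; rewrite coefB coefZ nth_default // mulr0 sub0r.
  rewrite -scalerAl coefZ coefXnM; case: ltnP => _; first by rewrite mulr0 oppr0.
  rewrite nth_default ?mulr0 ?oppr0 // leq_subRL ?subnK //.
  exact: leq_trans (leq_subr _ _) le_i.
have [k [Q [R [SQ SR lt_R eqQR]]]] := IHn _ (leq_trans lt_G1 le_Gn) G1 (leqnn _) SG1 F0.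
exists k.+1, (lead_coef F ^+ k *: U + Q), R; split=> //.
  move=> i; rewrite coefD; apply: subringD => //.
  by apply: polyinZ => //; apply: subring_exp.
rewrite mulrDl -addrA -eqQR exprSr -scalerA /G1 scalerBr scalerAl addrC subrK //.
Qed.

Definition adjoin1 S b (x : M) := exists2 G, polyin S G & x = G.[b].

Lemma adjoin1_subring S b : subring S -> subring (adjoin1 S b).
Proof.
move=> Ss; have [P1 PB PM] := polyin_subring Ss; split.
- by exists 1 => //; rewrite hornerC.
- by move=> _ _ [G SG ->] [H SH ->]; exists (G - H); [apply: PB | rewrite !hornerE].
- by move=> _ _ [G SG ->] [H SH ->]; exists (G * H); [apply: PM | rewrite !hornerE].
Qed.

Lemma sub_adjoin1 S b (x : M) : subring S -> S x -> adjoin1 S b x.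
Proof. by move=> Ss Sx; exists x%:P; rewrite ?hornerC //; apply: polyinC. Qed.

Lemma adjoin1_gen S b : subring S -> adjoin1 S b b.
Proof. by move=> Ss; exists 'X; rewrite ?hornerX //; apply: (polyinXn 1). Qed.

Definition adjoin_seq S (bs : seq M) := foldl adjoin1 S bs.

Lemma adjoin_seq_subring S bs : subring S -> subring (adjoin_seq S bs).
Proof. by elim: bs S => //= b bs IH S Ss; apply/IH/adjoin1_subring. Qed.

Lemma sub_adjoin_seq S bs (x : M) : subring S -> S x -> adjoin_seq S bs x.
Proof.
elim: bs S => //= b bs IH S Ss Sx.
by apply: IH; [apply: adjoin1_subring | apply: sub_adjoin1].
Qed.

Lemma adjoin_seq_gen S bs b : subring S -> b \in bs -> adjoin_seq S bs b.
Proof.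
elim: bs S => //= c bs IH S Ss; rewrite inE => /orP[/eqP->|bbs].
  by apply: sub_adjoin_seq; [apply: adjoin1_subring | apply: adjoin1_gen].
by apply: IH => //; apply: adjoin1_subring.
Qed.


Lemma adjoin1_min S T b : subring T -> (forall y, S y -> T y) -> T b ->
  forall y, adjoin1 S b y -> T y.
Proof.
move=> Ts ST Tb _ [G SG ->]; rewrite horner_coef; apply: subring_sum => // i _.
by have [_ _ TM] := Ts; apply: TM; [exact/ST/SG | apply: subring_exp].
Qed.

Lemma adjoin_seq_min S T bs : subring T -> (forall y, S y -> T y) ->
  (forall b, b \in bs -> T b) -> forall y, adjoin_seq S bs y -> T y.
Proof.
move=> Ts; elim: bs S => //= b bs IH S ST Tbs; apply: IH.
  by apply: adjoin1_min => //; apply: Tbs; rewrite mem_head.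
by move=> c cbs; apply: Tbs; rewrite inE cbs orbT.
Qed.

Definition ideal_span S (x : nat -> M) k y :=
  exists2 c : nat -> M, forall i, S (c i) & y = \sum_(i < k) c i * x i.

Lemma ideal_span_lin S (x : nat -> M) k a y z :
  subring S -> S a -> ideal_span S x k y -> ideal_span S x k z -> ideal_span S x k (z - a * y).
Proof.
move=> [_ SB SM] Sa [c Sc ->] [d Sd ->]; exists (fun i => d i - a * c i).
  by move=> i; apply/SB/SM.
by rewrite mulr_sumr -sumrB; apply: eq_bigr => i _; rewrite mulrBl mulrA.
Qed.

Lemma ideal_span_leq S (x : nat -> M) k l y : subring S -> (k <= l)%N ->
  ideal_span S x k y -> ideal_span S x l y.
Proof.
move=> Ss le_kl [c Sc ->]; exists (fun i => if (i < k)%N then c i else 0).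
  by move=> i; case: ifP => // _; apply: subring0.
rewrite (big_ord_widen _ (fun i => c i * x i) le_kl) big_mkcond.
by apply: eq_bigr => i _; case: ifP; rewrite // mul0r.
Qed.

Lemma ideal_span_gen S (x : nat -> M) k i : subring S -> (i < k)%N -> ideal_span S x k (x i).
Proof.
move=> Ss lt_ik; exists (fun j => (j == i)%:R).
  by move=> j; case: eqP => _; [case: Ss | apply: subring0].
rewrite (bigD1 (Ordinal lt_ik)) //= eqxx mul1r big1 ?addr0 // => j.
by rewrite -val_eqE /= => /negPf->; rewrite mul0r.
Qed.

Lemma ideal_span0 S (x : nat -> M) k : subring S -> ideal_span S x k 0.
Proof.
by move=> Ss; exists (fun=> 0) => [_|]; [apply: subring0 | rewrite big1 // => i; rewrite mul0r].
Qed.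

(** * Hilbert's basis theorem *)

(** The ascending chain condition, read on the chain of ideals generated by the
    initial segments of a sequence. *)
Definition noetherian S := forall a : nat -> M, (forall k, S (a k)) ->
  exists m, ideal_span S a m (a m).

Lemma argminn (d : nat -> nat) m :
  exists2 k, (m <= k)%N & forall l, (m <= l)%N -> (d k <= d l)%N.
Proof.
have ex : exists v, `[< exists2 k, (m <= k)%N & d k = v >].
  by exists (d m); apply/asboolP; exists m.
case: (ex_minnP ex) => v /asboolP[k mk <-] vmin; exists k => // l ml.
by apply: vmin; apply/asboolP; exists l.
Qed.

(** Repeatedly taking a later index at which d is minimal among all later ones. *)
Lemma min_subsequence (d : nat -> nat) : exists n : nat -> nat,
  (forall i j, (i < j)%N -> (n i < n j)%N) /\
  (forall i l, (n i <= l)%N -> (d (n i) <= d l)%N).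
Proof.
have /choice[next nextP] : forall m, exists k, (m <= k)%N /\ forall l, (m <= l)%N -> (d k <= d l)%N.
  by move=> m; have [k] := argminn d m; exists k.
pose n := fix n j := if j is i.+1 then next (n i).+1 else next 0%N.
exists n; split.
  move=> i j; elim: j => // j IHj; rewrite ltnS => le_ij.
  have [lt_n _] := nextP (n j).+1; move: le_ij; rewrite leq_eqVlt.
  by case/predU1P => [->|/IHj lt_ij] //; apply: ltn_trans lt_n.
case=> [|i] l /= le_l; first by have [_] := nextP 0%N; apply.
have [le1 le2] := nextP (n i).+1; apply: le2; exact: leq_trans le_l.
Qed.

(** Hilbert's argument.  If no x_k is in the ideal of its predecessors, let G_k be a
    polynomial of least degree whose value at b is x_k modulo this ideal, and pass
    to a subsequence along which the degrees are minimal among the later ones.  Some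
    leading coefficient is a combination of the previous ones over S, and
    the same combination of the shifted G_j lowers the degree of G_m. *)
Lemma adjoin1_noetherian S b : subring S -> noetherian S -> noetherian (adjoin1 S b).
Proof.
move=> Ss nS x Sx; apply: contrapT => nx.
have Sa := adjoin1_subring b Ss.
pose J k G := polyin S G /\ ideal_span (adjoin1 S b) x k (G.[b] - x k).
have /choice[G GP] : forall k, exists G, J k G /\ forall H, J k H -> (size G <= size H)%N.
  move=> k; have [G SG xG] := Sx k.
  have ex : exists v, `[< exists2 G, J k G & size G = v >].
    exists (size G); apply/asboolP; exists G => //; split=> //.
    by rewrite -xG subrr; apply: ideal_span0.
  case: (ex_minnP ex) => v /asboolP[H JH <-] vmin; exists H; split=> // K JK.
  by apply: vmin; apply/asboolP; exists K.
have G_neq0 k : G k != 0.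
  apply/eqP => G0; apply: nx; exists k; have [[_ sp] _] := GP k.
  move: sp; rewrite G0 horner0 => sp.
  have -> : x k = 0 - 1 * (0 - x k) by rewrite mul1r !sub0r opprK.
  by apply: ideal_span_lin => //; [case: Sa | apply: ideal_span0].
(* Without monotone degrees the shifts below would be negative. *)
have [n [n_incr n_min]] := min_subsequence (fun k => size (G k)).
have [m [c Sc lead_m]] :
    exists m, ideal_span S (fun j => lead_coef (G (n j))) m (lead_coef (G (n m))).
  apply: nS => j; rewrite /lead_coef; have [[SG _] _] := GP (n j); exact: SG.
(* The shifts that bring the leading terms of the G_j to the degree of G_m. *)
pose e (j : 'I_m) := (size (G (n m)) - size (G (n j)))%N.
have sz_e (j : 'I_m) : (e j + size (G (n j)) = size (G (n m)))%N.
  by rewrite subnK //; apply/n_min/ltnW/n_incr.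
pose H := G (n m) - \sum_(j < m) (c j *: 'X^(e j)) * G (n j).
have [[SGm spm] minm] := GP (n m).
have JH : J (n m) H.
  split.
    apply: polyinB => // i; rewrite coef_sum; apply: subring_sum => // j _.
    have [[SG _] _] := GP (n j).
    by apply: polyinM => //; apply: polyinZ => //; apply: polyinXn.
  have -> : H.[b] - x (n m) =
      (G (n m)).[b] - x (n m) - \sum_(j < m) c j * b ^+ (e j) * (G (n j)).[b].
    rewrite /H hornerD hornerN horner_sum addrAC; congr (_ - _).
    by apply: eq_bigr => j _; rewrite hornerM hornerZ hornerXn.
  have : forall j : 'I_m, ideal_span (adjoin1 S b) x (n m) (G (n j)).[b].
    move=> j; have [[_ sp] _] := GP (n j); have lt_nm := n_incr _ _ (ltn_ord j).
    rewrite -[(G (n j)).[b]](subrK (x (n j))) -[X in _ + X]opprK -[X in _ - X]mulN1r.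
    apply: ideal_span_lin => //; first by apply: subringN => //; case: Sa.
      exact: ideal_span_gen.
    exact: ideal_span_leq (ltnW lt_nm) sp.
  move=> spG; rewrite -[X in _ - X]big_enum /=.
  elim: (enum 'I_m) => [|j r IHr]; first by rewrite big_nil subr0.
  rewrite big_cons opprD addrA addrAC; apply: ideal_span_lin => //.
  have [_ _ aM] := Sa; apply: aM; first exact: sub_adjoin1.
  by apply: subring_exp => //; apply: adjoin1_gen.
have := minm _ JH; apply/negP; rewrite -ltnNge.
have szG_gt0 : (0 < size (G (n m)))%N by rewrite size_poly_gt0.
rewrite -(prednK szG_gt0) ltnS; apply/leq_sizeP => i; rewrite leq_eqVlt => /orP[/eqP<-|].
  rewrite coefB -lead_coefE lead_m coef_sum; apply/eqP; rewrite subr_eq0; apply/eqP.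
  apply: eq_bigr => j _; rewrite -scalerAl coefZ coefXnM.
  have sj0 : (0 < size (G (n j)))%N by rewrite size_poly_gt0.
  have -> : (size (G (n m))).-1 = (e j + (size (G (n j))).-1)%N.
    by rewrite -(sz_e j); case: (size (G (n j))) sj0 => // ? _; rewrite addnS.
  by rewrite ltnNge leq_addr /= addKn.
rewrite prednK // => le_i; rewrite coefB nth_default // sub0r coef_sum big1 ?oppr0 // => j _.
rewrite -scalerAl coefZ coefXnM; case: ltnP => [_|le_e]; first by rewrite mulr0.
by rewrite nth_default ?mulr0 // leq_subRL // sz_e.
Qed.

Lemma adjoin_seq_noetherian S bs : subring S -> noetherian S -> noetherian (adjoin_seq S bs).
Proof.
by elim: bs S => //= b bs IH S Ss nS; apply: IH; [apply: adjoin1_subring | apply: adjoin1_noetherian].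
Qed.

End Subrings.

Definition image (A B : comNzRingType) (g : {rmorphism A -> B}) : B -> Prop :=
  fun y => exists x, y = g x.

Lemma image_subring (A B : comNzRingType) (g : {rmorphism A -> B}) : subring (image g).
Proof.
split; first by exists 1; rewrite rmorph1.
  by move=> _ _ [a ->] [b ->]; exists (a - b); rewrite rmorphB.
by move=> _ _ [a ->] [b ->]; exists (a * b); rewrite rmorphM.
Qed.

(** * Extending homomorphisms to finitely generated extensions *)

Section Specialization.
Variables (L : fieldType) (C : closedFieldType).
Implicit Types (S : L -> Prop) (phi : L -> C) (b h : L) (G H : {poly L}).

(** Specializations: phi only matters on S, and its values elsewhere are junk. *)
Definition hom_on S phi :=
  [/\ phi 1 = 1, forall x y, S x -> S y -> phi (x - y) = phi x - phi y
    & forall x y, S x -> S y -> phi (x * y) = phi x * phi y].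

Lemma hom_on0 S phi : subring S -> hom_on S phi -> phi 0 = 0.
Proof. by move=> [S1 _ _] [_ phiB _]; rewrite -(subrr 1) phiB // subrr. Qed.

Lemma hom_onN S phi (x : L) : subring S -> hom_on S phi -> S x -> phi (- x) = - phi x.
Proof.
move=> Ss hphi Sx; have [_ phiB _] := hphi.
by rewrite -sub0r phiB // ?(hom_on0 Ss) ?sub0r //; apply: subring0.
Qed.

Lemma hom_onD S phi (x y : L) :
  subring S -> hom_on S phi -> S x -> S y -> phi (x + y) = phi x + phi y.
Proof.
move=> Ss hphi Sx Sy; have [_ phiB _] := hphi.
rewrite -[y in LHS]opprK phiB //; last exact: subringN.
by rewrite (hom_onN Ss hphi) // opprK.
Qed.

Lemma hom_on_sum S phi (I : Type) (r : seq I) (P : pred I) (F : I -> L) :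
  subring S -> hom_on S phi -> (forall i, P i -> S (F i)) ->
  phi (\sum_(i <- r | P i) F i) = \sum_(i <- r | P i) phi (F i).
Proof.
move=> Ss hphi SF.
suff [] : phi (\sum_(i <- r | P i) F i) = \sum_(i <- r | P i) phi (F i)
          /\ S (\sum_(i <- r | P i) F i) by [].
elim/big_rec2: _ => [|i y1 y2 Pi [IH Sy]]; first by rewrite (hom_on0 Ss) //; split=> //; apply: subring0.
by rewrite (hom_onD Ss hphi) ?IH //; [split=> //; apply: subringD; auto | apply: SF].
Qed.

Lemma hom_on_prod S phi (I : Type) (r : seq I) (P : pred I) (F : I -> L) :
  subring S -> hom_on S phi -> (forall i, P i -> S (F i)) ->
  phi (\prod_(i <- r | P i) F i) = \prod_(i <- r | P i) phi (F i).
Proof.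
move=> [S1 _ SM] [phi1 _ phiM] SF.
suff [] : phi (\prod_(i <- r | P i) F i) = \prod_(i <- r | P i) phi (F i)
          /\ S (\prod_(i <- r | P i) F i) by [].
elim/big_rec2: _ => [//|i y1 y2 Pi [IH Sy]].
by rewrite phiM ?IH //; [split=> //; apply: SM; auto | apply: SF].
Qed.

Lemma hom_onX S phi (x : L) k :
  subring S -> hom_on S phi -> S x -> phi (x ^+ k) = phi x ^+ k.
Proof.
move=> Ss hphi Sx; have [phi1 _ phiM] := hphi.
elim: k => [|k IHk]; rewrite ?expr0 // !exprS phiM ?IHk //; exact: subring_exp.
Qed.

Lemma coef_map_on S phi G i :
  subring S -> hom_on S phi -> (map_poly phi G)`_i = phi G`_i.
Proof. by move=> Ss hphi; rewrite coef_map_id0 // (hom_on0 Ss hphi). Qed.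

Lemma map_polyB_on S phi G H : subring S -> hom_on S phi -> polyin S G -> polyin S H ->
  map_poly phi (G - H) = map_poly phi G - map_poly phi H.
Proof.
move=> Ss hphi SG SH; apply/polyP => i; rewrite coefB !(coef_map_on _ _ Ss hphi) coefB.
by case: hphi => _ ->.
Qed.

Lemma map_polyM_on S phi G H : subring S -> hom_on S phi -> polyin S G -> polyin S H ->
  map_poly phi (G * H) = map_poly phi G * map_poly phi H.
Proof.
move=> Ss hphi SG SH; apply/polyP => i; rewrite coefM !(coef_map_on _ _ Ss hphi) coefM.
have [_ _ SM] := Ss; rewrite (hom_on_sum _ Ss hphi) => [|j _]; last by apply: SM; [exact: SG | exact: SH].
apply: eq_bigr => j _; rewrite !(coef_map_on _ _ Ss hphi).
by case: hphi => _ _ ->.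
Qed.

Lemma map_polyC_on S phi a : subring S -> hom_on S phi ->
  map_poly phi a%:P = (phi a)%:P.
Proof.
move=> Ss hphi; apply/polyP => i; rewrite !(coef_map_on _ _ Ss hphi) !coefC.
by case: eqP => // _; apply: hom_on0 hphi.
Qed.

Lemma hom_on_adjoin1 S phi b (t : C) : subring S -> hom_on S phi ->
  (forall G, polyin S G -> G.[b] = 0 -> (map_poly phi G).[t] = 0) ->
  exists2 psi, hom_on (adjoin1 S b) psi &
    forall G, polyin S G -> psi G.[b] = (map_poly phi G).[t].
Proof.
move=> Ss hphi Gt.
have [psi psiP] : exists psi : L -> C,
    forall x G, polyin S G -> x = G.[b] -> psi x = (map_poly phi G).[t].
  suff /choice[psi psiP] : forall x, exists c,
      forall G, polyin S G -> x = G.[b] -> c = (map_poly phi G).[t].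
    by exists psi => x; apply: psiP.
  move=> x; case: (pselect (adjoin1 S b x)) => [[G SG ->]|nx].
    exists (map_poly phi G).[t] => H SH /eqP; rewrite -subr_eq0 => /eqP GH.
    apply/eqP; rewrite -subr_eq0 -hornerN -hornerD -(map_polyB_on Ss) //; apply/eqP/Gt.
      exact: polyinB.
    by rewrite hornerD hornerN.
  by exists 0 => G SG Gx; case: nx; exists G.
have [P1 PB PM] := polyin_subring Ss.
exists psi; last by move=> G SG; apply: psiP.
split.
- rewrite (psiP _ 1) ?hornerC // (map_polyC_on _ Ss) // hornerC; by case: hphi.
- move=> _ _ [G SG ->] [H SH ->]; rewrite -hornerN -hornerD !(psiP _ _ _ erefl) //; last exact: PB.
  by rewrite (map_polyB_on Ss) // hornerD hornerN.
- move=> _ _ [G SG ->] [H SH ->]; rewrite -hornerM !(psiP _ _ _ erefl) //; last exact: PM.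
  by rewrite (map_polyM_on Ss) // hornerM.
Qed.

(** An equation of b of least degree with coefficients in S; being neither monic nor
    primitive, it is determined up to multiplication by elements of S. *)
Definition minimal_equation S b F :=
  [/\ polyin S F, F != 0, F.[b] = 0
    & forall G, polyin S G -> G.[b] = 0 -> G != 0 -> (size F <= size G)%N].

Lemma minimal_equation_exists S b G : polyin S G -> G != 0 -> G.[b] = 0 ->
  exists F, minimal_equation S b F.
Proof.
move=> SG G0 Gb.
have ex : exists v, `[< exists2 F, [/\ polyin S F, F != 0 & F.[b] = 0] & size F = v >].
  by exists (size G); apply/asboolP; exists G.
case: (ex_minnP ex) => v /asboolP[F [SF F0 Fb] <-] vmin; exists F; split=> // H SH Hb H0.
by apply: vmin; apply/asboolP; exists H.
Qed.

Lemma minimal_equation_div S b F G :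
  subring S -> minimal_equation S b F -> polyin S G -> G.[b] = 0 ->
  exists k, exists2 Q, polyin S Q & lead_coef F ^+ k *: G = Q * F.
Proof.
move=> Ss [SF F0 Fb Fmin] SG Gb.
have [k [Q [R [SQ SR lt_R eqQR]]]] := pseudo_division Ss SF SG F0.
exists k, Q => //; suff R0 : R = 0 by rewrite eqQR R0 addr0.
apply/eqP/negP => /negP nR0; move: lt_R; rewrite ltnNge Fmin //.
by have := congr1 (horner^~ b) eqQR; rewrite !hornerE Gb Fb !mulr0 add0r.
Qed.

(** A nonzero element of S[b] divides a nonzero element of S when b is algebraic.
    This is the Euclidean algorithm between F and a polynomial representing h: the last
    nonzero remainder is constant, since a common factor of positive degree would
    give a shorter equation of b. *)
Lemma minimal_equation_multiple S b F h :
  subring S -> minimal_equation S b F -> adjoin1 S b h -> h != 0 ->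
  exists2 w, adjoin1 S b w & S (w * h) /\ w * h != 0.
Proof.
move=> Ss mF [H SH ->]; have Sa := adjoin1_subring b Ss; have [_ _ aM] := Sa.
have [SF F0 Fb Fmin] := mF.
have horn G : polyin S G -> adjoin1 S b G.[b] by exists G.
elim/ltn_ind: {H}(size H) {-2}H (leqnn (size H)) SH => n IHn H le_Hn SH Hb.
have H0 : H != 0 by apply: contraNneq Hb => ->; rewrite horner0.
have lH G : polyin S G -> G != 0 -> S (lead_coef G) /\ lead_coef G != 0.
  by move=> SG G0; split; [apply: SG | rewrite lead_coef_eq0].
have [le_H1|lt_H1] := leqP (size H) 1.
  have [a eqH] : exists a, H = a%:P by exists H`_0; apply: size1_polyC.
  exists 1; first by case: Sa.
  by rewrite mul1r; split=> //; rewrite eqH hornerC; have := SH 0%N; rewrite eqH coefC.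
have [lt_FH|le_HF] := ltnP (size F) (size H).
  have [k [Q [R [SQ SR lt_R eqQR]]]] := pseudo_division Ss SF SH F0.
  have eqb : lead_coef F ^+ k * H.[b] = R.[b].
    by have := congr1 (horner^~ b) eqQR; rewrite !hornerE Fb mulr0 add0r.
  have [Sl l0] := lH F SF F0.
  have Rb : R.[b] != 0 by rewrite -eqb mulf_neq0 // expf_neq0.
  have [w Sw [Sw1 w1]] := IHn _ (leq_trans (ltn_trans lt_R lt_FH) le_Hn) R (leqnn _) SR Rb.
  exists (w * lead_coef F ^+ k); last by rewrite -mulrA eqb.
  by apply: aM => //; apply: sub_adjoin1 => //; apply: subring_exp.
have [k [Q [R [SQ SR lt_R eqQR]]]] := pseudo_division Ss SH SF H0.
have eqb : R.[b] = - (Q.[b] * H.[b]).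
  by have /eqP := congr1 (horner^~ b) eqQR; rewrite !hornerE Fb mulr0 eq_sym addrC addr_eq0 => /eqP.
have [Rb|Rb] := eqVneq R.[b] 0.
  have Qb : Q.[b] = 0.
    by move/eqP: Rb; rewrite eqb oppr_eq0 mulf_eq0 (negPf Hb) orbF => /eqP.
  have [Sl l0] := lH H SH H0.
  have R0 : R = 0.
    apply: contraTeq lt_R => nR; rewrite -leqNgt; apply: leq_trans le_HF _.
    exact: Fmin.
  have lF : lead_coef H ^+ k *: F != 0 by rewrite scaler_eq0 negb_or expf_neq0.
  have Q0 : Q != 0.
    by apply: contraNneq lF => Q0; rewrite eqQR Q0 R0 mul0r addr0.
  have := Fmin Q SQ Qb Q0; rewrite -(size_scale F (expf_neq0 k l0)) eqQR R0 addr0.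
  rewrite size_mul //; case: (size H) lt_H1 => [|[|m]] // _.
  by rewrite !addnS /= -ltn_subRL subnn.
have [w Sw [Sw1 w1]] := IHn _ (leq_trans lt_R le_Hn) R (leqnn _) SR Rb.
exists (- (w * Q.[b])); first by apply: subringN => //; apply: aM => //; apply: horn.
by rewrite mulNr -mulrA -mulrN -eqb.
Qed.

(** Once phi does not kill the leading coefficient of the minimal equation F, every
    polynomial relation of b is a multiple of F after specialization, so b can be sent
    to an arbitrary root of the specialized F.  Multiplying d by a multiple of h in S
    keeps the image of h away from 0. *)
Lemma hom_ext_algebraic S b F h :
  subring S -> minimal_equation S b F -> adjoin1 S b h -> h != 0 ->
  exists2 d, S d /\ d != 0 & forall phi, hom_on S phi -> phi d != 0 ->
    forall t, (map_poly phi F).[t] = 0 ->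
    exists psi, [/\ hom_on (adjoin1 S b) psi, forall x, S x -> psi x = phi x,
      psi b = t & psi h != 0].
Proof.
move=> Ss mF Sh h0; have [SF F0 Fb Fmin] := mF.
have [w Sw [Swh wh0]] := minimal_equation_multiple Ss mF Sh h0.
have [S1 _ SM] := Ss.
exists (lead_coef F * (w * h)).
  by split; [apply: SM => //; apply: SF | rewrite mulf_neq0 // lead_coef_eq0].
move=> phi hphi; have [phi1 _ phiM] := hphi.
have Sl : S (lead_coef F) by apply: SF.
rewrite phiM // mulf_eq0 negb_or => /andP[phil phiwh] t Ft.
have [G SG Gb|psi hpsi psiP] := @hom_on_adjoin1 S phi b t Ss hphi.
  have [k [Q SQ eqQ]] := minimal_equation_div Ss mF SG Gb.
  have : phi (lead_coef F ^+ k) * (map_poly phi G).[t] = 0.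
    rewrite -hornerZ -mul_polyC -(map_polyC_on _ Ss hphi).
    rewrite -(map_polyM_on Ss hphi) //; last by apply: polyinC => //; apply: subring_exp.
    by rewrite mul_polyC eqQ (map_polyM_on Ss) // hornerM Ft mulr0.
  by move/eqP; rewrite mulf_eq0 (hom_onX _ Ss) // expf_eq0 (negPf phil) andbF => /eqP.
have psiS x : S x -> psi x = phi x.
  by move=> Sx; rewrite -[x in LHS](hornerC _ b) psiP ?(map_polyC_on _ Ss) ?hornerC //; apply: polyinC.
exists psi; split=> //.
  rewrite -[b in LHS]hornerX psiP; last exact: (polyinXn 1).
  rewrite -[X in _ = X]hornerX; congr (_.[_]); apply/polyP => i.
  rewrite (coef_map_on _ _ Ss hphi) !coefX; case: eqP => _ //=; exact: hom_on0 hphi.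
apply: contraNneq phiwh => psih.
have [_ _ psiM] := hpsi.
by rewrite -psiS // psiM // psih mulr0.
Qed.

(** The step of the induction in [hom_ext_seq].  The nonzero element h stands for the
    condition that the later steps impose on the specialization. *)
Lemma hom_ext S b h : subring S -> adjoin1 S b h -> h != 0 ->
  exists2 d, S d /\ d != 0 & forall phi, hom_on S phi -> phi d != 0 ->
    exists psi, [/\ hom_on (adjoin1 S b) psi, forall x, S x -> psi x = phi x & psi h != 0].
Proof.
move=> Ss Sh h0.
case: (pselect (exists2 G, polyin S G /\ G != 0 & G.[b] = 0)) => [[G [SG G0] Gb]|tr].
  have [F mF] := minimal_equation_exists SG G0 Gb; have [SF F0 Fb Fmin] := mF.
  have [d [Sd d0] ext] := hom_ext_algebraic Ss mF Sh h0.
  have [S1 _ SM] := Ss; have Sl : S (lead_coef F) by apply: SF.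
  exists (d * lead_coef F); first by split; [apply: SM | rewrite mulf_neq0 // lead_coef_eq0].
  move=> phi hphi; have [_ _ phiM] := hphi; rewrite phiM // mulf_eq0 negb_or => /andP[phid phil].
  have : size (map_poly phi F) != 1%N.
    rewrite size_poly_eq //; apply/eqP => szF; move: F0 Fb.
    by rewrite [F]size1_polyC ?szF // hornerC polyC_eq0 => /eqP.
  move/closed_rootP=> [t /rootP Ft].
  by have [psi [? ? _ ?]] := ext phi hphi phid t Ft; exists psi.
have [H SH eqh] := Sh; have H0 : H != 0 by apply: contraNneq h0 => H0; rewrite eqh H0 horner0.
exists (lead_coef H); first by split; [apply: SH | rewrite lead_coef_eq0].
move=> phi hphi phil.
have : map_poly phi H != 0.
  rewrite -lead_coef_eq0; apply: contraNneq phil => l0.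
  have : (map_poly phi H)`_(size H).-1 = phi (lead_coef H) by rewrite (coef_map_on _ _ Ss).
  move=> <-; have [lt|le] := ltnP (size (map_poly phi H)) (size H); last first.
    have szH : size (map_poly phi H) = size H.
      by apply/eqP; rewrite eqn_leq le andbT size_poly.
    by move/eqP: l0; rewrite lead_coefE szH => /eqP->.
  rewrite nth_default // -ltnS prednK //; exact: leq_ltn_trans lt.
move/closed_nonrootP=> [t Ht].
have [G SG Gb|psi hpsi psiP] := @hom_on_adjoin1 S phi b t Ss hphi.
  have [->|G0] := eqVneq G 0; first by rewrite map_poly0 horner0.
  by case: tr; exists G.
exists psi; split=> //; last by rewrite eqh psiP.
by move=> x Sx; rewrite -[x in LHS](hornerC _ b) psiP ?(map_polyC_on _ Ss) ?hornerC //; apply: polyinC.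
Qed.

(** Generic extension of specializations: Chevalley's theorem in the form used for
    the Nullstellensatz and for the generic points of a variety. *)
Lemma hom_ext_seq S bs : subring S ->
  exists2 d, S d /\ d != 0 & forall phi, hom_on S phi -> phi d != 0 ->
    exists2 psi, hom_on (adjoin_seq S bs) psi & forall x, S x -> psi x = phi x.
Proof.
elim: bs S => [|b bs IH] S Ss /=.
  by exists 1; [split; [case: Ss | apply: oner_neq0] | move=> phi hphi _; exists phi].
have Sb := adjoin1_subring b Ss.
have [h [Sh h0] exth] := IH _ Sb.
have [d Sd extd] := hom_ext Ss Sh h0; exists d => // phi hphi phid.
have [psi [hpsi psiE psih]] := extd phi hphi phid.
have [psi2 hpsi2 psi2E] := exth psi hpsi psih.
by exists psi2 => // x Sx; rewrite psi2E ?psiE //; apply: sub_adjoin1.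
Qed.

Lemma hom_on_image (A : comNzRingType) (g : {rmorphism A -> L}) (chi : {rmorphism A -> C}) :
  injective g -> exists2 phi, hom_on (image g) phi & forall x, phi (g x) = chi x.
Proof.
move=> g_inj.
have /choice[phi phiP] : forall a, exists c, forall x, a = g x -> c = chi x.
  move=> a; case: (pselect (image g a)) => [[x ->]|na].
    by exists (chi x) => y /g_inj->.
  by exists 0 => x ax; case: na; exists x.
have phiE x : phi (g x) = chi x by apply: phiP.
exists phi => //; split; first by rewrite -(rmorph1 g) phiE rmorph1.
  by move=> _ _ [a ->] [b ->]; rewrite -rmorphB !phiE rmorphB.
by move=> _ _ [a ->] [b ->]; rewrite -rmorphM !phiE rmorphM.
Qed.

End Specialization.

(** * Residue fields of prime ideals *)

Definition ideal (M : comNzRingType) (P : M -> Prop) :=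
  [/\ P 0, forall x y, P x -> P y -> P (x + y) & forall a x, P x -> P (a * x)].

Definition prime_ideal (M : comNzRingType) (P : M -> Prop) :=
  [/\ ideal P, ~ P 1 & forall x y, P (x * y) -> P x \/ P y].

Section PrimeResidueField.
#[local] Open Scope quotient_scope.
Variables (M : comNzRingType) (P : M -> Prop) (P_prime : prime_ideal P).

Definition prime_pred : M -> bool := fun x => `[< P x >].

Fact prime_pred_idealr : idealr_closed prime_pred.
Proof.
have [[P0 PD PM] P1 _] := P_prime; split; first exact/asboolP.
  by apply/negP => /asboolP.
move=> a x y /asboolP Px /asboolP Py; apply/asboolP.
by apply: PD => //; apply: PM.
Qed.

Fact prime_pred_prime : prime_idealr_closed prime_pred.
Proof.
have [_ _ PM] := P_prime.
move=> x y /asboolP /PM[Px|Py]; apply/orP; [left|right]; exact/asboolP.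
Qed.

HB.instance Definition _ := isIdealr.Build M prime_pred prime_pred_idealr.
HB.instance Definition _ := isPrimeIdealrClosed.Build M prime_pred prime_pred_prime.

Let primeI : prime_idealr M := prime_pred.

Definition prime_quotient : Type := {ideal_quot primeI}.

HB.instance Definition _ := GRing.ComNzRing.on prime_quotient.

(** Fields of fractions are formed over rings with units; classical choice
    provides an inverse function on any commutative ring. *)
Definition quotient_unit : pred prime_quotient := fun x => `[< exists y, y * x = 1 >].
Definition quotient_inv (x : prime_quotient) : prime_quotient :=
  if pselect (exists y, y * x = 1) is left ex then projT1 (cid ex) else x.

Fact quotient_mulVx : {in quotient_unit, left_inverse 1 quotient_inv *%R}.
Proof.
move=> x /asboolP ex; rewrite /quotient_inv; case: pselect => // ex'.
by case: cid.
Qed.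

Fact quotient_unitP x y : y * x = 1 -> quotient_unit x.
Proof. by move=> yx; apply/asboolP; exists y. Qed.

Fact quotient_inv_out : {in [predC quotient_unit], quotient_inv =1 id}.
Proof.
move=> x /asboolP nx; rewrite /quotient_inv; case: pselect => // ex.
Qed.

HB.instance Definition _ := GRing.ComNzRing_hasMulInverse.Build prime_quotient
  quotient_mulVx quotient_unitP quotient_inv_out.

HB.instance Definition _ := GRing.ComUnitRing_isIntegral.Build prime_quotient
  (@Quotient.rquot_IdomainAxiom M primeI).

Definition prime_residue (x : M) : {fraction prime_quotient} :=
  tofrac (\pi_{ideal_quot primeI} x : prime_quotient).

Fact prime_residue_zmod : zmod_morphism prime_residue.
Proof. by move=> x y; rewrite /prime_residue -rmorphB; congr tofrac; rewrite rmorphB. Qed.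

Fact prime_residue_monoid : monoid_morphism prime_residue.
Proof.
split; first by rewrite /prime_residue -[RHS](rmorph1 (@tofrac prime_quotient)); congr tofrac; rewrite rmorph1.
by move=> x y; rewrite /prime_residue -rmorphM; congr tofrac; rewrite rmorphM.
Qed.

HB.instance Definition _ := GRing.isZmodMorphism.Build M {fraction prime_quotient}
  prime_residue prime_residue_zmod.
HB.instance Definition _ := GRing.isMonoidMorphism.Build M {fraction prime_quotient}
  prime_residue prime_residue_monoid.

Lemma prime_residue_eq0 x : (prime_residue x = 0) <-> P x.
Proof.
rewrite /prime_residue; split => [/eqP|Px].
  rewrite tofrac_eq0 => /eqP/eqP.
  rewrite -[0](rmorph0 (\pi_{ideal_quot primeI})) -Quotient.idealrBE subr0 => /asboolP//.
apply/eqP; rewrite tofrac_eq0; apply/eqP.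
apply/eqP; rewrite -[0](rmorph0 (\pi_{ideal_quot primeI})) -Quotient.idealrBE subr0; exact/asboolP.
Qed.

End PrimeResidueField.

(** The field of fractions of M/P.  For M a polynomial ring, the images of the variables are
    the coordinates of a generic point of the variety of P. *)
Lemma prime_residue_field (M : comNzRingType) (P : M -> Prop) : prime_ideal P ->
  exists (L : fieldType) (psi : {rmorphism M -> L}), forall x, psi x = 0 <-> P x.
Proof.
move=> P_prime; exists {fraction prime_quotient P_prime}, (prime_residue P_prime).
exact: prime_residue_eq0.
Qed.

(** An ideal containing J and maximal among those without a power of q is prime. *)
Lemma prime_avoiding (M : comNzRingType) (J : M -> Prop) q :
  ideal J -> (forall k, ~ J (q ^+ k)) ->
  exists P, [/\ prime_ideal P, forall x, J x -> P x & ~ P q].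
Proof.
move=> [J0 JD JM] Jq.
pose good (P : set M) := [/\ ideal P, forall x, J x -> P x & forall k, ~ P (q ^+ k)].
have [F Fgood Ftot|A [[A0|gA] maxA]] := @Zorn_bigcup M (fun A => A = set0 \/ good A).
- case: (pselect (exists2 A, F A & good A)) => [[A FA gA]|nF]; last first.
    left; rewrite -subset0 => x [A FA Ax]; have [A0|gA] := Fgood A FA.
      by rewrite A0 in Ax.
    by case: nF; exists A.
  right; have Fid B x : F B -> B x -> ideal B.
    by move=> FB Bx; case: (Fgood B FB) => [B0|[]//]; rewrite B0 in Bx.
  have [[A0 AD AM] JA Aq] := gA; split.
  + split; first by exists A.
      move=> x y [B FB Bx] [D FD Dy]; have [BD|DB] := Ftot B D FB FD.
        by exists D => //; have [_ DD _] := Fid _ _ FD Dy; apply: DD => //; apply: BD.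
      by exists B => //; have [_ BD _] := Fid _ _ FB Bx; apply: BD => //; apply: DB.
    by move=> a x [B FB Bx]; exists B => //; have [_ _] := Fid _ _ FB Bx; apply.
  + by move=> x Jx; exists A => //; apply: JA.
  + by move=> k [B FB Bq]; have [B0|[_ _ /(_ k)]//] := Fgood B FB; rewrite B0 in Bq.
- have gJ : good J by split.
  case: (maxA J); last by right.
  split; first by rewrite A0; apply: sub0set.
  by move=> JA; have := JA 0 J0; rewrite A0.
have [[A0 AD AM] JA Aq] := gA; exists A; split=> //; last by move: (Aq 1%N); rewrite expr1.
split=> //; first by move: (Aq 0%N); rewrite expr0.
move=> x y Axy; apply: contrapT => /not_orP[nAx nAy].
(* Adding z to A must produce a power of q, by maximality. *)
have bigger z : ~ A z -> exists k a, A (q ^+ k - a * z).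
  move=> nAz; pose B : set M := fun u => exists2 a, A (u - a * z) & True.
  apply: contrapT => nB; case: (maxA B).
    split; first by move=> u Au; exists 0; rewrite // mul0r subr0.
    by move=> BA; apply: nAz; apply: BA; exists 1; rewrite // mul1r subrr.
  right; split.
  + split; first by exists 0; rewrite // mul0r subr0.
      move=> u v [a Au _] [b Av _]; exists (a + b) => //.
      by rewrite mulrDl opprD addrACA; apply: AD.
    by move=> c u [a Au _]; exists (c * a) => //; rewrite -mulrA -mulrBr; apply: AM.
  + by move=> u Ju; exists 0; rewrite // mul0r subr0; apply: JA.
  + by move=> k [a Ak _]; apply: nB; exists k, a.
have [k [a Ak]] := bigger x nAx; have [l [b Al]] := bigger y nAy.
apply: (Aq (k + l)%N); rewrite exprD.
have -> : q ^+ k * q ^+ l = q ^+ l * (q ^+ k - a * x) + a * x * (q ^+ l - b * y) + (a * b) * (x * y).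
  rewrite !mulrBr (mulrC (q ^+ l) (q ^+ k)) (mulrC (q ^+ l) (a * x)) mulrACA.
  by rewrite addrA !subrK.
by apply: (AD); [apply: (AD); apply: (AM) | apply: (AM)].
Qed.

(** * Polynomials along curves *)

Lemma mmap_var (K S : comNzRingType) n (f : {rmorphism K -> S}) (h : 'I_n -> S) i :
  mmap f h (mpolyX K (mnm1 i)) = h i.
Proof. by rewrite mmapX mmap1U. Qed.

Lemma rmorph_mmap (K S T : comNzRingType) n (f : {rmorphism K -> S})
    (g : {rmorphism S -> T}) (h : 'I_n -> S) p :
  g (mmap f h p) = mmap (g \o f) (g \o h) p.
Proof.
rewrite /mmap rmorph_sum; apply: eq_bigr => m _; rewrite rmorphM /mmap1 rmorph_prod.
by congr (_ * _); apply: eq_bigr => i _; rewrite rmorphXn.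
Qed.

Lemma eq_mmap (K S : comNzRingType) n (f g : K -> S) (h k : 'I_n -> S) p :
  f =1 g -> h =1 k -> mmap f h p = mmap g k p.
Proof.
move=> fg hk; rewrite /mmap; apply: eq_bigr => m _; rewrite fg; congr (_ * _).
by rewrite /mmap1; apply: eq_bigr => i _; rewrite hk.
Qed.

Lemma mmap_id (K : comNzRingType) n (p : mpoly n K) :
  mmap (@mpolyC n K) (fun i => mpolyX K (mnm1 i)) p = p.
Proof.
rewrite [RHS]mpolyE /mmap; apply: eq_bigr => m _.
by rewrite mul_mpolyC mmap1_id.
Qed.

Lemma mmap_subring (K S : comNzRingType) n (f : K -> S) (h : 'I_n -> S) (T : S -> Prop) p :
  subring T -> (forall c, T (f c)) -> (forall i, T (h i)) -> T (mmap f h p).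
Proof.
move=> Ts Tf Th; have [_ _ TM] := Ts; rewrite /mmap; apply: subring_sum => // m _.
by apply: TM => //; apply: subring_prod => // i _; apply: subring_exp.
Qed.

Lemma mpoly_noetherian (K : fieldType) n : noetherian (fun _ : mpoly n K => True).
Proof.
pose S0 := image (@mpolyC n K); have sS0 : subring S0 by apply: image_subring.
have nS0 : noetherian S0.
  move=> a Sa; have [c0 a0] := Sa 0%N; have [c1 a1] := Sa 1%N.
  have [c00|c0N] := eqVneq c0 0.
    by exists 0%N; exists (fun=> 0) => [_|]; [apply: subring0 | rewrite big_ord0 a0 c00 rmorph0].
  exists 1%N; exists (fun=> mpolyC n (c1 / c0)) => [_|]; first by exists (c1 / c0).
  by rewrite big_ord1 a0 a1 -[mpolyC n _]/(GRing.RMorphism.sort _ _) -rmorphM divfK.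
have nS := @adjoin_seq_noetherian _ _ [seq mpolyX K (mnm1 i) | i <- enum 'I_n] sS0 nS0.
move=> a _; have [|m [c _ eqa]] := nS a; last by exists m; exists c.
move=> k; rewrite -(mmap_id (a k)); apply: mmap_subring.
- exact: adjoin_seq_subring.
- by move=> c; apply: sub_adjoin_seq => //; exists c.
- by move=> i; apply: adjoin_seq_gen => //; apply: map_f; rewrite mem_enum.
Qed.

(** Uniqueness of the expansion in base N. *)
Lemma digits_inj N r (f g : 'I_r -> nat) : (forall i, f i < N)%N -> (forall i, g i < N)%N ->
  (\sum_i f i * N ^ i = \sum_i g i * N ^ i)%N -> f =1 g.
Proof.
elim: r f g => [|r IHr] f g ltf ltg; first by move=> _ [].
have step (h : 'I_r.+1 -> nat) : (\sum_i h i * N ^ i = (\sum_(i < r) h (lift ord0 i) * N ^ i) * N + h ord0)%N.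
  rewrite big_ord_recl expn0 muln1 addnC big_distrl /=; congr addn; apply: eq_bigr => i _.
  by rewrite -mulnA -expnSr /bump add1n.
rewrite !step => eqfg.
have N0 : (0 < N)%N := leq_ltn_trans (leq0n _) (ltf ord0).
have eq0 : f ord0 = g ord0.
  by have := congr1 (modn^~ N) eqfg; rewrite !modnMDl !modn_small.
have eqS : (\sum_(i < r) f (lift ord0 i) * N ^ i = \sum_(i < r) g (lift ord0 i) * N ^ i)%N.
  by move/eqP: eqfg; rewrite eq0 eqn_add2r eqn_pmul2r // => /eqP.
have {}IHr := IHr _ _ (fun i => ltf (lift ord0 i)) (fun i => ltg (lift ord0 i)) eqS.
by move=> i; case: (unliftP ord0 i) => [j ->|-> //]; apply: IHr.
Qed.

Section Curve.
Variables (K : fieldType) (r : nat).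
Implicit Types (p : mpoly r K).

(** The polynomial in w obtained by moving along the curve z_i + w^(N^i).  For N
    large the monomials of p acquire distinct degrees in w, as in Nagata's change of
    variables; contrary to generic lines these curves need no choice of a direction. *)
Definition along_curve N : mpoly r K -> {poly mpoly r K} :=
  mmap (polyC \o @mpolyC r K) (fun i => (mpolyX K (mnm1 i))%:P + 'X^(N ^ i)).

(** The monomial of exponent m contributes a monic polynomial of degree
    sum_i m_i N^i, and these degrees differ by uniqueness of the expansion in base N, so
    exactly one coefficient of p survives in top degree. *)
Lemma along_curve_lead N p : p != 0 -> (msize p <= N)%N ->
  exists2 c, c != 0 & lead_coef (along_curve N p) = mpolyC r c.
Proof.
move=> p0 le_pN.
have N0 : (0 < N)%N.
  apply: leq_trans le_pN; rewrite lt0n.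
  by apply: contraNneq p0 => /eqP; rewrite mmeasure_poly_eq0.
pose h i : {poly mpoly r K} := (mpolyX K (mnm1 i))%:P + 'X^(N ^ i).
pose wt (m : multinom r) := (\sum_i m i * N ^ i)%N.
have mon m : mmap1 h m \is monic /\ size (mmap1 h m) = (wt m).+1.
  have monM (p1 p2 : {poly mpoly r K}) a b : p1 \is monic /\ size p1 = a.+1 ->
      p2 \is monic /\ size p2 = b.+1 -> p1 * p2 \is monic /\ size (p1 * p2) = (a + b).+1.
    move=> [m1 s1] [m2 s2]; split; first by rewrite monicMl.
    by rewrite size_Mmonic ?monic_neq0 // s1 s2 addSn addnS.
  rewrite /mmap1 /wt; elim/big_rec2: _ => [|i a q _ IH]; first by rewrite monic1 size_poly1.
  apply: (monM) => //; elim: (m i) => [|k IHk]; first by rewrite expr0 monic1 size_poly1.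
  rewrite exprS mulSn; apply: (monM) => //; rewrite /h addrC.
  have Ni : (0 < N ^ i)%N by rewrite expn_gt0 N0.
  by rewrite monicXnaddC // size_XnaddC.
have wt_inj : {in msupp p &, injective wt}.
  move=> m1 m2 m1p m2p /digits_inj eqm; apply/mnmP; apply: eqm => i.
    by apply: leq_ltn_trans (leq_trans (msize_mdeg_lt m1p) le_pN); rewrite mdegE (bigD1 i) //= ?leq_addr.
  by apply: leq_ltn_trans (leq_trans (msize_mdeg_lt m2p) le_pN); rewrite mdegE (bigD1 i) //= ?leq_addr.
have [m0 m0p m0max] : exists2 m0, m0 \in msupp p & forall m, m \in msupp p -> (wt m <= wt m0)%N.
  have : msupp p != [::] by rewrite msupp_eq0.
  elim: (msupp p) => // m s IH _; have [->|/IH[m1 m1s m1max]] := eqVneq s [::].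
    by exists m; rewrite ?mem_head // => m'; rewrite inE => /eqP->.
  have [le|lt] := leqP (wt m) (wt m1).
    by exists m1; rewrite ?inE ?m1s ?orbT // => m'; rewrite inE => /predU1P[->|/m1max].
  exists m; rewrite ?mem_head // => m'; rewrite inE => /predU1P[->|/m1max le] //.
  exact: leq_trans le (ltnW lt).
exists (mcoeff m0 p); first by rewrite -mcoeff_msupp.
rewrite /along_curve /mmap (bigD1_seq m0) ?msupp_uniq //= mul_polyC.
have [mon0 sz0] := mon m0.
have c0 : mpolyC r (mcoeff m0 p) != 0.
  by rewrite mpolyC_eq0 -mcoeff_msupp.
rewrite lead_coefDl; first by rewrite lead_coefZ (monicP mon0) mulr1.
rewrite size_scale // sz0 ltnS; apply: leq_trans (size_sum _ _ _) _.
apply/bigmax_leqP_seq => m mp m_m0; rewrite /= mul_polyC.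
apply: leq_trans (size_scale_leq _ _) _; have [_ ->] := mon m.
by rewrite ltn_neqAle m0max // andbT; apply: contra m_m0 => /eqP/wt_inj->.
Qed.

Lemma along_curveE (T : comNzRingType) (f : {rmorphism K -> T}) (h : 'I_r -> T) N p w :
  (map_poly (mmap f h) (along_curve N p)).[w] = mmap f (fun i => h i + w ^+ (N ^ i)) p.
Proof.
have -> : (map_poly (mmap f h) (along_curve N p)).[w] =
    (horner_eval w \o map_poly (mmap f h)) (along_curve N p) by [].
rewrite /along_curve rmorph_mmap; apply: eq_mmap => [c|i] /=; rewrite /horner_eval.
  by rewrite map_polyC /= hornerC mmapC.
rewrite rmorphD /= map_polyC map_polyXn hornerD hornerC hornerXn /=.
by rewrite mmap_var.
Qed.

End Curve.

(** * Noether normalization *)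

Section Noether.
Variables (K L : fieldType) (f : {rmorphism K -> L}).

Definition alg_independent r (z : 'I_r -> L) :=
  forall p : mpoly r K, mmap f z p = 0 -> p = 0.

Lemma integral_subring (R : comNzRingType) (g : {rmorphism R -> L}) : subring (integralOver g).
Proof.
by split; [apply: integral1 | apply: integral_sub | apply: integral_mul].
Qed.

Lemma integral_const r (z : 'I_r -> L) c : integralOver (mmap f z) (f c).
Proof. by rewrite -(mmapC z f); apply: integral_id. Qed.

Lemma integral_gen r (z : 'I_r -> L) i : integralOver (mmap f z) (z i).
Proof. by rewrite -(mmap_var f z); apply: integral_id. Qed.

Lemma integral_trans r (z : 'I_r -> L) r' (z' : 'I_r' -> L) x :
  (forall i, integralOver (mmap f z') (z i)) -> integralOver (mmap f z) x ->
  integralOver (mmap f z') x.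
Proof.
move=> zz' [p p_mon px]; apply: (integral_root_monic (p := map_poly (mmap f z) p)) => //.
  exact: monic_map.
apply/integral_poly => i; rewrite coef_map; apply: mmap_subring => //.
  exact: integral_subring.
exact: integral_const.
Qed.

(** With w = z_0 and z_i = z'_i + w^(N^i), the relation p becomes an equation of w over
    the z' with constant leading coefficient.  As z'_0 = 0, one generator is
    saved. *)
Lemma noether_step r (z : 'I_r -> L) p : p != 0 -> mmap f z p = 0 ->
  exists r' (q : 'I_r' -> mpoly r K), (r' < r)%N /\
    forall i, integralOver (mmap f (mmap f z \o q)) (z i).
Proof.
move=> p0 pz; pose N := msize p; have [c c0 lead_p] := along_curve_lead p0 (leqnn N).
move: N lead_p => N lead_p.
case: r z p p0 pz lead_p => [|r] z p p0 pz lead_p.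
  case/eqP: p0; have p_const : p = mpolyC 0 (mcoeff mnm0 p).
    apply/mpolyP => m; rewrite mcoeffC; have -> : m = mnm0 by apply/mnmP; case.
    by rewrite eqxx mulr1.
  move: pz; rewrite p_const mmapC => /eqP; rewrite fmorph_eq0 => /eqP->.
  by rewrite mpolyC0.
pose w := z ord0.
pose q (j : 'I_r) : mpoly r.+1 K := mpolyX K (mnm1 (lift ord0 j)) - mpolyX K (mnm1 ord0) ^+ (N ^ lift ord0 j).
exists r, q; split=> //; set y := mmap f z \o q.
have yE j : y j = z (lift ord0 j) - w ^+ (N ^ lift ord0 j).
  by rewrite /y /= rmorphB rmorphXn /= !mmap_var.
pose z' (i : 'I_r.+1) := z i - w ^+ (N ^ i).
pose rho : {rmorphism mpoly r.+1 K -> mpoly r K} :=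
  mmap (@mpolyC r K) (fun i => if unlift ord0 i is Some j then mpolyX K (mnm1 j) else 0).
have rhoE u : mmap f y (rho u) = mmap f z' u.
  rewrite /rho /= rmorph_mmap; apply: eq_mmap => [a|i] /=; first by rewrite mmapC.
  case: (unliftP ord0 i) => [j ->|->]; first by rewrite mmap_var yE.
  by rewrite rmorph0 /z' expn0 expr1 subrr.
have w_int : integralOver (mmap f y) w.
  exists (mpolyC r c^-1 *: map_poly rho (along_curve N p)).
    rewrite monicE lead_coefZ lead_coef_map_eq lead_p; rewrite /rho /= mmapC.
      by rewrite -mpolyCM mulVf.
    by rewrite mpolyC_eq0.
  rewrite /root map_polyZ hornerZ -map_poly_comp.
  rewrite (eq_map_poly (g := mmap f z')) //.
  rewrite along_curveE (eq_mmap (g := f) (k := z)) ?pz ?mulr0 //.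
  by move=> i; rewrite /z' subrK.
have iS := integral_subring (mmap f y).
move=> i; have -> : z i = z' i + w ^+ (N ^ i) by rewrite subrK.
apply: subringD => //; last exact: subring_exp.
case: (unliftP ord0 i) => [j ->|->]; first by rewrite /z' -yE; apply: integral_gen.
by rewrite /z' expn0 expr1 subrr; exact: subring0 iS.
Qed.

Theorem noether_normalization n (x : 'I_n -> L) :
  exists r (q : 'I_r -> mpoly n K), alg_independent (mmap f x \o q) /\
    forall i, integralOver (mmap f (mmap f x \o q)) (x i).
Proof.
pose good r := exists q : 'I_r -> mpoly n K, forall i, integralOver (mmap f (mmap f x \o q)) (x i).
have ex : exists r, `[< good r >].
  exists n; apply/asboolP; exists (fun i => mpolyX K (mnm1 i)) => i.
  by rewrite -[x i](mmap_var f x); apply: (@integral_gen _ (mmap f x \o _)).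
case: (ex_minnP ex) => r /asboolP[q qx] rmin; exists r, q; split=> // p pz.
apply/eqP/negP => /negP p0; have [r' [q' [lt_r' q'z]]] := noether_step p0 pz.
have : (r <= r')%N; last by rewrite leqNgt lt_r'.
apply: rmin; apply/asboolP; exists (fun j => mmap (@mpolyC n K) q (q' j)) => i.
have -> : mmap f (mmap f x \o (fun j => mmap (@mpolyC n K) q (q' j))) =
          mmap f (mmap f (mmap f x \o q) \o q').
  apply: funext => u; apply: eq_mmap => // j /=.
  by rewrite rmorph_mmap; apply: eq_mmap => [a|k] //=; rewrite mmapC.
exact: integral_trans (qx i).
Qed.

End Noether.

(** * Generic points and the Nullstellensatz *)

Section GenericPoint.
Variable C : closedFieldType.

Lemma hom_on_mmap (L : fieldType) (S : L -> Prop) (phi : L -> C) n (f : {rmorphism C -> L})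
    (h : 'I_n -> L) p : subring S -> hom_on S phi -> (forall c, S (f c)) ->
  (forall i, S (h i)) -> phi (mmap f h p) = mmap (phi \o f) (phi \o h) p.
Proof.
move=> Ss hphi Sf Sh; have [_ _ SM] := Ss; have [_ _ phiM] := hphi.
have Sm m : S (mmap1 h m) by apply: subring_prod => // i _; apply: subring_exp.
rewrite /mmap (hom_on_sum _ Ss hphi) => [|m _]; last exact: SM.
apply: eq_bigr => m _; rewrite phiM //; congr (_ * _).
rewrite /mmap1 (hom_on_prod _ Ss hphi) => [|i _]; last exact: subring_exp.
by apply: eq_bigr => i _; rewrite (hom_onX _ Ss hphi).
Qed.

(** The constant term of an equation of u is a multiple of u; this clears
    denominators in fractions of integral elements. *)
Lemma integral_multiple (R : comNzRingType) (L : fieldType) (g : {rmorphism R -> L}) u :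
  injective g -> integralOver g u -> u != 0 ->
  exists2 w, integralOver g w & exists2 d, d != 0 & w * u = g d.
Proof.
move=> g_inj u_int u0; have iS := integral_subring g.
pose S := image g; have Ss : subring S := image_subring g.
have [p p_mon /rootP pu] := u_int.
have Sp : polyin S (map_poly g p) by move=> i; rewrite coef_map; exists p`_i.
have [F mF] := minimal_equation_exists Sp (monic_neq0 (monic_map g p_mon)) pu.
have [w [G SG ->] [[d eqd] wu0]] := minimal_equation_multiple Ss mF (adjoin1_gen u Ss) u0.
exists G.[u].
  apply: integral_horner => //; apply/integral_poly => i.
  by have [a ->] := SG i; apply: integral_id.
exists d => //; apply: contraNneq wu0 => d0; by rewrite eqd d0 rmorph0.
Qed.

Lemma integral_fraction_algebraic (R : comNzRingType) (L : fieldType) (g : {rmorphism R -> L})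
    t s : injective g -> integralOver g t -> integralOver g s -> s != 0 ->
  exists2 G : {poly R}, G != 0 & (map_poly g G).[t / s] = 0.
Proof.
move=> g_inj t_int s_int s0.
have [w w_int [d d0 ws]] := integral_multiple g_inj s_int s0.
have w0 : w != 0.
  by apply: contraNneq d0 => w0; apply/eqP/g_inj; rewrite -ws w0 mul0r rmorph0.
have gd0 : g d != 0 by rewrite -ws mulf_neq0.
have [p p_mon /rootP pu] := integral_mul t_int w_int.
have pE : p = \poly_(k < size p) p`_k by rewrite coefK.
exists (\poly_(k < size p) (p`_k * d ^+ k)).
  have sp : (0 < size p)%N by rewrite size_poly_gt0 monic_neq0.
  apply/eqP => /polyP/(_ (size p).-1); rewrite coef_poly prednK // leqnn coef0 -lead_coefE.
  rewrite (monicP p_mon) mul1r => dk; have : g (d ^+ (size p).-1) = 0 by rewrite dk rmorph0.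
  by move/eqP; rewrite rmorphXn expf_eq0 (negPf gd0) andbF.
have -> : t / s = t * w / g d by rewrite -ws invfM mulrA mulfK.
rewrite -pu; set u := t * w.
rewrite (@horner_coef_wide _ (size p)); last exact: leq_trans (size_poly _ _) (size_poly _ _).
rewrite [in RHS](@horner_coef_wide _ (size p)); last exact: size_poly.
apply: eq_bigr => k _; rewrite !coef_map coef_poly ltn_ord /= rmorphM rmorphXn -mulrA; congr (_ * _).
by rewrite expr_div_n mulrCA divff ?mulr1 // expf_neq0.
Qed.

Variables (n : nat).
Implicit Types (p q s t : mpoly n C).

(** With psi the residue map of P, the fraction kappa = psi t / psi s has a minimal
    equation F over the image of C[z].  A point z off the zero set of d specializes
    the image of C[z]; kappa can be sent to any root tau of F(z, T), and the
    specialization extends to the coordinates and to 1/psi s, which produces the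
    point y.  The relation satisfied by kappa is stated in homogenized form, so that
    it concerns polynomials. *)
Theorem generic_lift (P : mpoly n C -> Prop) : prime_ideal P ->
  exists r (q : 'I_r -> mpoly n C),
  (forall i, exists2 E : {poly mpoly r C}, E \is monic &
     P (map_poly (mmap (@mpolyC n C) q) E).[mpolyX C (mnm1 i)]) /\
  (forall u, P (mmap (@mpolyC n C) q u) -> u = 0) /\
  forall s t, ~ P s -> exists (F : {poly mpoly r C}) (d : mpoly r C),
    [/\ F != 0, d != 0,
      P (\sum_(k < size F) mmap (@mpolyC n C) q F`_k * t ^+ k * s ^+ (size F - k)) &
      forall z tau, meval z d != 0 -> (map_poly (meval z) F).[tau] = 0 ->
        exists y : 'I_n -> C, [/\ forall p, P p -> meval y p = 0,
          forall j, meval y (q j) = z j, meval y s != 0 & meval y s * tau = meval y t]].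
Proof.
move=> P_prime; have [L [psi psi0]] := prime_residue_field P_prime.
pose iota : {rmorphism C -> L} := psi \o @mpolyC n C.
pose x i := psi (mpolyX C (mnm1 i)).
have psiE p : psi p = mmap iota x p.
  by rewrite -[in LHS](mmap_id p) rmorph_mmap.
have [r [q [z_indep x_int]]] := noether_normalization iota x.
exists r, q; set z := mmap iota x \o q in z_indep x_int.
pose g : {rmorphism mpoly r C -> L} := mmap iota z.
have g_inj : injective g.
  move=> a b /eqP; rewrite -subr_eq0 -rmorphB => /eqP/z_indep/eqP.
  by rewrite subr_eq0 => /eqP.
have gE u : g u = psi (mmap (@mpolyC n C) q u).
  by rewrite psiE rmorph_mmap; apply: eq_mmap => [c|j] //=; rewrite mmapC.
split; [move=> i | split=> [u /psi0|s t Ps]].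
- have [E E_mon /rootP Ex] := x_int i; exists E => //; apply/psi0.
  rewrite -Ex -horner_map /= -map_poly_comp; congr (_.[_]).
  by apply: eq_map_poly => u /=; rewrite -gE.
- by rewrite -gE; apply: z_indep.
have int_psi p : integralOver g (psi p).
  rewrite psiE; apply: mmap_subring => //; first exact: integral_subring.
  exact: integral_const.
have psis : psi s != 0 by apply/eqP => /psi0.
pose kappa := psi t / psi s.
have [G G0 Gk] := integral_fraction_algebraic g_inj (int_psi t) (int_psi s) psis.
pose S := image g; have Ss : subring S := image_subring g.
have SG : polyin S (map_poly g G) by move=> i; rewrite coef_map; exists G`_i.
have gG0 : map_poly g G != 0 by rewrite map_poly_eq0_id0 // -(rmorph0 g) (inj_eq g_inj) lead_coef_eq0.
have [F' mF'] := minimal_equation_exists SG gG0 Gk.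
have [SF' F'0 F'k F'min] := mF'.
have [F eqF] : exists F, F' = map_poly g F.
  have /choice[c cP] : forall i, exists d, F'`_i = g d by [].
  exists (\poly_(i < size F') c i); apply/polyP => i; rewrite coef_map coef_poly.
  by case: ltnP => [_|le]; [exact: cP | rewrite nth_default //= rmorph0].
have F0 : F != 0 by apply: contraNneq F'0 => F0; rewrite eqF F0 rmorph0.
pose S1 := adjoin1 S kappa; have Ss1 : subring S1 := adjoin1_subring kappa Ss.
(* Inverting psi s forces s to be nonzero at the point obtained. *)
pose bs := (psi s)^-1 :: [seq x i | i <- enum 'I_n].
have [d1 [Sd1 d10] ext1] := hom_ext_seq C bs Ss1.
have [_ [[d ->] d0] ext0] := hom_ext_algebraic C Ss mF' Sd1 d10.
exists F, d; split=> //.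
- by apply: contraNneq d0 => ->; rewrite rmorph0.
- apply/psi0; rewrite rmorph_sum /=.
  have : psi s ^+ size F * F'.[kappa] = 0 by rewrite F'k mulr0.
  rewrite eqF (@horner_coef_wide _ (size F)) ?size_poly // mulr_sumr => sum0.
  apply: etrans sum0; apply: eq_bigr => k _; rewrite !rmorphM !rmorphXn coef_map -gE /kappa expr_div_n.
  have -> : psi s ^+ size F = psi s ^+ k * psi s ^+ (size F - k).
    by rewrite -exprD subnKC // ltnW.
  by rewrite [RHS]mulrC mulrA -(mulrA _ _ (psi s ^+ k)) divfK // expf_neq0.
move=> w tau wd Ftau.
have [phi hphi phiE] := hom_on_image (meval w) g_inj.
have [||psi1 [hpsi1 psi1E psi1k psi1d]] := ext0 phi hphi _ tau.
- by rewrite phiE.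
- rewrite -Ftau; congr (_.[_]); apply/polyP => i.
  by rewrite (coef_map_on _ _ Ss hphi) eqF !coef_map phiE.
have [psi2 hpsi2 psi2E] := ext1 psi1 hpsi1 psi1d.
pose S2 := adjoin_seq S1 bs; have Ss2 : subring S2 := adjoin_seq_subring bs Ss1.
have S12 a : S1 a -> S2 a by apply: sub_adjoin_seq.
have S01 a : S a -> S1 a by apply: sub_adjoin1.
have iotaE c : iota c = g (mpolyC r c) by rewrite /g /= mmapC.
have Sx i : S2 (x i).
  by apply: adjoin_seq_gen => //; rewrite inE map_f ?orbT // mem_enum.
have Sc c : S2 (iota c) by apply/S12/S01; exists (mpolyC r c).
have Spsi p : S2 (psi p) by rewrite psiE; apply: mmap_subring.
have psi2S u : psi2 (g u) = meval w u.
  by rewrite psi2E ?psi1E ?phiE //; [exists u | apply: S01; exists u].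
pose y := psi2 \o x; have yE p : meval y p = psi2 (psi p).
  rewrite psiE (hom_on_mmap _ Ss2) //; apply: eq_mmap => // c.
  by rewrite /= [psi _](iotaE c) psi2S mevalC.
have [psi21 _ psi2M] := hpsi2.
have Ssinv : S2 (psi s)^-1 by apply: adjoin_seq_gen => //; rewrite inE eqxx.
exists y; split=> [p Pp|j||].
- by rewrite yE (_ : psi p = 0) ?(hom_on0 Ss2) //; apply/psi0.
- rewrite yE psiE -[mmap _ _ _]/(z j) -(mmap_var iota z) -[mmap iota z _]/(g _) psi2S.
  exact: mevalXU.
- rewrite yE; apply/eqP => psi2s; have := psi2M _ _ (Spsi s) Ssinv.
  by rewrite divff // psi21 psi2s mul0r => /eqP; rewrite oner_eq0.
have Sk : S2 kappa by apply: S12; apply: adjoin1_gen.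
have tE : psi t = psi s * kappa by rewrite mulrC divfK.
have psi2k : psi2 kappa = tau by rewrite psi2E //; apply: adjoin1_gen.
by rewrite !yE -psi2k tE (psi2M _ _ (Spsi s) Sk).
Qed.

End GenericPoint.

(** A prime ideal that contains J and no power of q gives a field, in which the
    homomorphism c |-> c on the constants extends to the generators and to 1/q. *)
Theorem nullstellensatz (C : closedFieldType) (M : comNzRingType) (f : {rmorphism C -> M})
    (bs : seq M) (J : M -> Prop) q :
  (forall x, adjoin_seq (image f) bs x) -> ideal J ->
  (forall k, ~ J (q ^+ k)) ->
  exists chi : {rmorphism M -> C}, [/\ forall c, chi (f c) = c,
    forall x, J x -> chi x = 0 & chi q != 0].
Proof.
move=> gen J_ideal Jq; have [P [P_prime JP Pq]] := prime_avoiding J_ideal Jq.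
have [L [psi psi0]] := prime_residue_field P_prime.
pose g : {rmorphism C -> L} := psi \o f.
have g_inj : injective g := fmorph_inj g.
pose S := image g; have Ss : subring S := image_subring g.
have psiq : psi q != 0 by apply/eqP => /psi0.
pose cs := (psi q)^-1 :: map psi bs.
have [_ [[d ->] d0] ext] := hom_ext_seq C cs Ss.
have [phi hphi phiE] := hom_on_image (idfun : {rmorphism C -> C}) g_inj.
have [|psi2 hpsi2 psi2E] := ext phi hphi.
  by rewrite phiE /=; apply: contraNneq d0 => ->; rewrite rmorph0.
pose S2 := adjoin_seq S cs; have Ss2 : subring S2 := adjoin_seq_subring cs Ss.
have S2psi x : S2 (psi x).
  have preS : subring (fun y => S2 (psi y)).
    have [S21 S2B S2M] := Ss2; split; first by rewrite rmorph1.
      by move=> a b; rewrite rmorphB; apply: S2B.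
    by move=> a b; rewrite rmorphM; apply: S2M.
  apply: (adjoin_seq_min preS) (gen x) => [_ [c ->]|b bbs].
    by apply: sub_adjoin_seq => //; exists c.
  by apply: adjoin_seq_gen => //; rewrite inE map_f ?orbT.
have [psi21 psi2B psi2M] := hpsi2.
have zm : zmod_morphism (psi2 \o psi).
  by move=> x y /=; rewrite rmorphB psi2B //; exact: S2psi.
have mm : monoid_morphism (psi2 \o psi).
  by split=> [|x y] /=; [rewrite rmorph1 | rewrite rmorphM psi2M //; exact: S2psi].
pose chi : {rmorphism M -> C} := HB.pack (psi2 \o psi)
  (GRing.isZmodMorphism.Build M C (psi2 \o psi) zm)
  (GRing.isMonoidMorphism.Build M C (psi2 \o psi) mm).
exists chi; split=> [c|x Jx|] /=.
- by rewrite [psi _]/(g c) psi2E ?phiE //; exists c.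
- by rewrite (_ : psi x = 0) ?(hom_on0 Ss2) //; apply/psi0/JP.
have Ssinv : S2 (psi q)^-1 by apply: adjoin_seq_gen => //; rewrite inE eqxx.
apply/eqP => psi2s; have := psi2M _ _ (S2psi q) Ssinv.
by rewrite divff // psi21 psi2s mul0r => /eqP; rewrite oner_eq0.
Qed.

(** * Estimates for complex polynomials *)

Section Estimates.
Variable C : numClosedFieldType.
Implicit Types (p q a c d : {poly C}) (w e rho : C).

Lemma horner_norm_le p w rho : `|w| <= rho -> `|p.[w]| <= \sum_(k < size p) `|p`_k| * rho ^+ k.
Proof.
move=> le_w; rewrite horner_coef; apply: le_trans (ler_norm_sum _ _ _) _.
apply: ler_sum => k _; rewrite normrM ler_wpM2l // normrX.
by apply: lerXn2r; rewrite ?nnegrE // (le_trans _ le_w).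
Qed.

Lemma monic_root_le p w : p \is monic -> root p w -> `|w| <= 1 + \sum_(k < size p) `|p`_k|.
Proof.
move=> p_mon /rootP pw; set B := \sum_(k < _) _.
have B0 : 0 <= B by apply: sumr_ge0.
have [le_w1|lt_w1] := real_leP (normr_real w) (real1 C).
  by apply: le_trans le_w1 _; rewrite lerDl.
suff le_wB : `|w| <= B by apply: le_trans le_wB _; rewrite lerDr.
have sp : (0 < size p)%N by rewrite size_poly_gt0 monic_neq0.
have w0 : 0 < `|w| := lt_trans ltr01 lt_w1.
move: pw; rewrite horner_coef /B -(prednK sp) big_ord_recr /= => /eqP.
rewrite -lead_coefE (monicP p_mon) mul1r addrC addr_eq0 => /eqP pw.
rewrite big_ord_recr /= -lead_coefE (monicP p_mon) normr1.
move: (size p).-1 pw => m pw.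
case: m pw => [|m]; first by rewrite big_ord0 expr0 oppr0 => /eqP; rewrite oner_eq0.
move=> pw; have : `|w| ^+ m.+1 <= (\sum_(k < m.+1) `|p`_k|) * `|w| ^+ m.
  rewrite -normrX pw normrN mulr_suml; apply: le_trans (ler_norm_sum _ _ _) _.
  apply: ler_sum => k _; rewrite normrM ler_wpM2l // normrX ler_weXn2l ?ltW //.
  by rewrite -ltnS.
rewrite exprS ler_pM2r ?exprn_gt0 // => le_w; apply: le_trans le_w _.
by rewrite lerDl.
Qed.

Lemma horner_small p e : p.[0] = 0 -> 0 < e ->
  exists2 h, 0 < h <= 1 & forall w, `|w| <= h -> `|p.[w]| < e.
Proof.
move=> /rootP/factor_theorem[q ->] e0.
pose B := \sum_(k < size q) `|q`_k| * 1 ^+ k.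
have B0 : 0 <= B by apply: sumr_ge0 => k _; rewrite mulr_ge0 // exprn_ge0.
have eB : 0 < e + B + 1 by rewrite ltr_wpDl ?ltr01 // addr_ge0 // ltW.
exists (e / (e + B + 1)).
  rewrite divr_gt0 //= ler_pdivrMr // mul1r -addrA lerDl addr_ge0 //.
move=> w le_w; rewrite hornerM hornerXsubC subr0 normrM.
have w1 : `|w| <= 1.
  apply: le_trans le_w _; rewrite ler_pdivrMr // mul1r -addrA lerDl addr_ge0 //.
apply: le_lt_trans (ler_pM _ _ (horner_norm_le q w1) le_w) _ => //.
rewrite -/B mulrA ltr_pdivrMr // mulrC ltr_pM2l //.
by rewrite addrAC ltrDr ltr_pwDl.
Qed.

(** Finitely many polynomials vanishing at 0 are small near 0, where d has no other
    zero.  All limits below are taken along curves and reduce to this. *)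
Lemma poly_common_small (s : seq {poly C}) d e : (forall p, p \in s -> p.[0] = 0) ->
  0 < e -> d != 0 -> exists2 w, d.[w] != 0 & forall p, p \in s -> `|p.[w]| < e.
Proof.
move=> s0 e0 d0.
have [h /andP[h0 h1] hs] : exists2 h, 0 < h <= 1 & forall w, `|w| <= h -> forall p, p \in s -> `|p.[w]| < e.
  elim: s s0 => [|p s IH] s0; first by exists 1; rewrite // ltr01 lexx.
  have [h /andP[h0 h1] hs] := IH (fun q qs => s0 q (mem_behead (s := p :: s) qs)).
  have [h' /andP[h'0 h'1] h'p] := horner_small (s0 p (mem_head _ _)) e0.
  exists (h * h'); first by rewrite mulr_gt0 //= mulr_ile1 // ltW.
  move=> w le_w q; rewrite inE => /predU1P[->|qs].
    by apply: h'p; apply: le_trans le_w _; rewrite ler_piMl // ltW.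
  by apply: hs => //; apply: le_trans le_w _; rewrite ler_piMr // ltW.
have [k [d' d'0 dE]] := multiplicity_XsubC d 0.
move: d'0; rewrite d0 /= => d'0.
have [||h' /andP[h'0 h'1] h'd] := @horner_small (d' - (d'.[0])%:P) `|d'.[0]|.
- by rewrite !hornerE subrr.
- by rewrite normr_gt0; exact: d'0.
have hh : 0 < h * h' by rewrite mulr_gt0.
have hhn : `|h * h'| = h * h' by rewrite gtr0_norm.
exists (h * h').
  rewrite dE hornerM horner_exp hornerXsubC subr0.
  apply: mulf_neq0; last by rewrite expf_neq0 // lt0r_neq0.
  apply/eqP => d'h; have := h'd (h * h'); rewrite hhn ler_piMl // ?(ltW h'0) // => /(_ isT).
  by rewrite !hornerE d'h sub0r normrN ltxx.
by apply: hs; rewrite hhn ler_piMr // ltW.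
Qed.

(** A root of a is a root of c, by letting w tend to it off the zeros of d; dividing
    both by the linear factor preserves the bound, which takes care of
    multiplicities. *)
Lemma dvdp_of_bounded a c d : a != 0 -> d != 0 ->
  (forall rho, 0 <= rho -> exists2 B, 0 <= B &
     forall w, `|w| <= rho -> d.[w] != 0 -> `|c.[w]| <= B * `|a.[w]|) ->
  a %| c.
Proof.
elim/ltn_ind: {a}(size a) {-2}a (leqnn (size a)) c d => n IHn a le_an c d a0 d0 bnd.
have [sz1|] := eqVneq (size a) 1%N.
  by have := size_poly_eq1 a; rewrite sz1 eqxx => /esym a1; rewrite (eqp_dvdl _ a1) dvd1p.
move/closed_rootP=> [x ax].
have cx : root c x.
  apply/rootP/eqP/negP => /negP cx; pose e0 := `|c.[x]|.
  have e0_gt0 : 0 < e0 by rewrite normr_gt0.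
  (* Chosen so that e < 1 and 2 e < e0. *)
  pose e := e0 / (2 + e0).
  have e20 : 0 < 2 + e0 by rewrite addr_gt0.
  have e_gt0 : 0 < e by rewrite divr_gt0.
  have e_lt1 : e < 1 by rewrite ltr_pdivrMr // mul1r ltrDr.
  have e_lt : e + e < e0.
    have eE : e * (2 + e0) = e0 by rewrite divfK // gt_eqF.
    by rewrite -[ltRHS]eE mulrDr mulr_natr mulr2n ltrDl mulr_gt0.
  have [B B0 Bbnd] := bnd (`|x| + 1) (addr_ge0 (normr_ge0 x) ler01).
  have d'0 : d \Po ('X + x%:P) != 0 by rewrite comp_poly_eq0 // size_XaddC.
  have [|w dw small] := @poly_common_small
      [:: 'X; (c \Po ('X + x%:P)) - (c.[x])%:P; B *: (a \Po ('X + x%:P))] _ e _ e_gt0 d'0.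
    move=> p; rewrite !inE => /or3P[] /eqP ->; rewrite ?hornerE //.
      by rewrite horner_comp !hornerE subrr.
    by rewrite horner_comp !hornerE (rootP ax) mulr0.
  have := small 'X; rewrite hornerX !inE eqxx => /(_ isT) w_small.
  have := small ((c \Po ('X + x%:P)) - (c.[x])%:P).
  rewrite !inE eqxx orbT => /(_ isT); rewrite hornerD hornerN horner_comp !hornerE => c_small.
  have := small (B *: (a \Po ('X + x%:P))).
  rewrite !inE eqxx !orbT => /(_ isT).
  rewrite hornerZ horner_comp !hornerE normrM (ger0_norm B0) => a_small.
  move: dw; rewrite horner_comp !hornerE => dw.
  have le_wx : `|w + x| <= `|x| + 1.
    apply: le_trans (ler_normD _ _) _; rewrite addrC lerD2l ltW //.
    exact: lt_trans e_lt1.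
  have c_le := le_lt_trans (Bbnd _ le_wx dw) a_small.
  have : e0 < e + e.
    rewrite /e0 -[c.[x]](subKr c.[w + x]).
    apply: le_lt_trans (ler_normB _ _) _.
    by apply: ltrD.
  by move/lt_trans/(_ e_lt); rewrite ltxx.
have /factor_theorem[a' aE] := ax; have /factor_theorem[c' cE] := cx.
rewrite aE cE dvdp_mul2r ?polyXsubC_eq0 //.
have a'0 : a' != 0 by apply: contraNneq a0 => a'0; rewrite aE a'0 mul0r.
apply: (IHn (size a') _ a' (leqnn _) c' (d * ('X - x%:P))) => //.
- apply: leq_trans le_an; rewrite aE size_Mmonic ?monicXsubC // size_XsubC addn2 //.
- by rewrite mulf_neq0 // polyXsubC_eq0.
move=> rho rho0; have [B B0 Bbnd] := bnd rho rho0; exists B => // w le_w.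
rewrite hornerM mulf_eq0 negb_or hornerXsubC => /andP[dw wx].
have := Bbnd w le_w dw; rewrite aE cE !hornerM !hornerXsubC !normrM mulrA ler_pM2r //.
by rewrite normr_gt0.
Qed.

Lemma coef_prod_XsubC_le (s : seq C) M k : 0 <= M -> (forall x, x \in s -> `|x| <= M) ->
  `|(\prod_(x <- s) ('X - x%:P))`_k| <= (1 + M) ^+ size s.
Proof.
move=> M0; elim: s k => [|x s IH] k sM.
  by rewrite big_nil coef1 expr0; case: k => [|k]; rewrite ?normr1 ?normr0.
rewrite big_cons mulrBl coefB coefXM coefCM exprS mulrDl mul1r.
have {}IH j : `|(\prod_(x <- s) ('X - x%:P))`_j| <= (1 + M) ^+ size s.
  by apply: IH => y ys; apply: sM; rewrite inE ys orbT.
apply: le_trans (ler_normB _ _) _; apply: lerD.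
  by case: k => [|k] //=; rewrite normr0 exprn_ge0 // addr_ge0.
by rewrite normrM ler_pM // sM // mem_head.
Qed.

Lemma coef_le_of_roots p M k : 0 <= M -> (forall x, root p x -> `|x| <= M) ->
  `|p`_k| <= (1 + M) ^+ (size p).-1 * `|lead_coef p|.
Proof.
move=> M0; have [->|p0] := eqVneq p 0; first by rewrite coef0 lead_coef0 normr0 mulr0.
have [s pE] := closed_field_poly_normal p; move=> sM.
rewrite {1}pE coefZ normrM mulrC ler_wpM2r //.
have l0 : lead_coef p != 0 by rewrite lead_coef_eq0.
have -> : (size p).-1 = size s by rewrite pE size_scale // size_prod_XsubC.
apply: coef_prod_XsubC_le => // x xs; apply: sM.
by rewrite pE rootZ // root_prod_XsubC.
Qed.

(** The value p(x) is the product of the distances from x to the roots. *)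
Lemma root_near p x e : p \is monic -> 0 < e -> `|p.[x]| < e ^+ (size p).-1 ->
  exists2 y, root p y & `|y - x| < e.
Proof.
move=> p_mon e0; have [s] := closed_field_poly_normal p.
rewrite (monicP p_mon) scale1r => pE.
rewrite pE size_prod_XsubC /= horner_prod normr_prod => lt_e.
have [/hasP[y ys lt_y]|/hasPn no] := boolP (has (fun y => `|y - x| < e) s).
  by exists y => //; rewrite root_prod_XsubC.
move: lt_e; rewrite real_ltNge; last 2 first.
- by apply: ger0_real; apply: prodr_ge0.
- by apply: ger0_real; apply: exprn_ge0; apply: ltW.
case/negP; elim: s no {pE} => [|y s IH] no; first by rewrite big_nil expr0.
rewrite big_cons exprS ler_pM ?(ltW e0) ?exprn_ge0 ?(ltW e0) //.
  rewrite hornerXsubC distrC real_leNgt ?normr_real ?(gtr0_real e0) //.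
  by apply: no; rewrite mem_head.
by apply: IH => z zs; apply: no; rewrite inE zs orbT.
Qed.

End Estimates.

Section MultivariateEstimates.
Variables (C : numClosedFieldType) (r : nat).
Implicit Types (a c d p : mpoly r C) (z : 'I_r -> C).

Definition curve N z w : 'I_r -> C := fun i => z i + w ^+ (N ^ i).

Lemma meval_curve N z p w :
  (map_poly (meval z) (along_curve N p)).[w] = meval (curve N z w) p.
Proof. exact: (@along_curveE _ _ _ idfun). Qed.

Lemma along_curve_map_neq0 N z p : p != 0 -> (msize p <= N)%N ->
  map_poly (meval z) (along_curve N p) != 0.
Proof.
move=> p0 le_pN; have [c c0 lead_p] := along_curve_lead p0 le_pN.
have lz : meval z (lead_coef (along_curve N p)) != 0 by rewrite lead_p mevalC.
by rewrite -lead_coef_eq0 lead_coef_map_eq.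
Qed.

Lemma meval_inj p : (forall z, meval z p = 0) -> p = 0.
Proof.
move=> pz; apply/eqP/negP => /negP p0.
have /closed_nonrootP[w] := along_curve_map_neq0 (fun=> 0) p0 (leqnn _).
by rewrite /root meval_curve pz eqxx.
Qed.

Lemma curve_norm_le N z w rho i : `|w| <= rho ->
  `|curve N z w i| <= \sum_j (`|z j| + rho ^+ (N ^ j)).
Proof.
move=> le_w; have rho0 : 0 <= rho := le_trans (normr_ge0 w) le_w.
rewrite (bigD1 i) //=; apply: le_trans (ler_normD _ _) _.
apply: le_trans (_ : `|z i| + rho ^+ (N ^ i) <= _).
  by rewrite lerD2l normrX lerXn2r ?nnegrE.
by rewrite lerDl sumr_ge0 // => j _; rewrite addr_ge0 // exprn_ge0.
Qed.

(** Along each curve z_i + w^(N^i) the polynomial a divides c, by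
    [dvdp_of_bounded].  As a has constant leading coefficient along these curves, the
    division can be performed with z as a parameter; its remainder vanishes at
    every z, hence is 0, and w = 0 gives the quotient. *)
Theorem bounded_quotient a c d : a != 0 -> d != 0 ->
  (forall M, 0 <= M -> exists2 B, 0 <= B & forall z, (forall i, `|z i| <= M) ->
     meval z d != 0 -> `|meval z c| <= B * `|meval z a|) ->
  exists m, c = m * a.
Proof.
move=> a0 d0 bnd; pose N := (msize a + msize d).+1.
have [l l0 lead_a] := along_curve_lead a0 (leqW (leq_addr _ _) : msize a <= N)%N.
pose A := mpolyC r l^-1 *: along_curve N a.
have A_mon : A \is monic by rewrite monicE lead_coefZ lead_a -mpolyCM mulVf.
have cE := Pdiv.RingMonic.rdivp_eq A_mon (along_curve N c).
set Q := Pdiv.CommonRing.rdivp _ _ in cE; set R := Pdiv.CommonRing.rmodp _ _ in cE.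
have szR : (size R < size A)%N by rewrite Pdiv.CommonRing.ltn_rmodp monic_neq0.
have R0 : R = 0.
  apply/polyP => k; rewrite coef0; apply: meval_inj => z.
  suff : map_poly (meval z) R = 0 by move/polyP/(_ k); rewrite coef_map coef0.
  have cEz : map_poly (meval z) (along_curve N c) =
      map_poly (meval z) Q * map_poly (meval z) A + map_poly (meval z) R.
    by rewrite {1}cE rmorphD rmorphM.
  have Az_mon : map_poly (meval z) A \is monic by apply: monic_map.
  have szA : size (map_poly (meval z) A) = size A.
    by rewrite size_map_poly_id0 // (monicP A_mon) rmorph1 oner_neq0.
  have Aa : map_poly (meval z) A %= map_poly (meval z) (along_curve N a).
    have lz : meval z (mpolyC r l^-1) != 0 by rewrite mevalC invr_neq0.
    rewrite /A map_polyZ; exact: eqp_scale.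
  have : map_poly (meval z) A %| map_poly (meval z) (along_curve N c).
    rewrite (eqp_dvdl _ Aa).
    apply: (@dvdp_of_bounded _ _ _ (map_poly (meval z) (along_curve N d))).
    - by apply: along_curve_map_neq0 => //; apply/leqW/leq_addr.
    - by apply: along_curve_map_neq0 => //; apply/leqW/leq_addl.
    move=> rho rho0; have [|B B0 Bbnd] := bnd (\sum_j (`|z j| + rho ^+ (N ^ j))).
      by apply: sumr_ge0 => j _; rewrite addr_ge0 // exprn_ge0.
    exists B; [exact: B0 | move=> w le_w dw].
    have := Bbnd (curve N z w) (fun i => curve_norm_le N z i le_w).
    by rewrite -!meval_curve; apply; exact: dw.
  rewrite cEz dvdp_addr; last exact: dvdp_mulIr.
  move=> AR; apply/eqP/negP => /negP Rz0; have := dvdp_leq Rz0 AR.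
  by rewrite szA leqNgt (leq_ltn_trans (size_poly _ _) szR).
have curve0 p : (along_curve N p).[0] = p.
  have := along_curveE (@mpolyC r C) (fun i => mpolyX C (mnm1 i)) N p 0.
  rewrite (eq_map_poly (g := idfun)) ?map_poly_id //; last exact: mmap_id.
  move=> ->; rewrite -[RHS]mmap_id; apply: eq_mmap => // i.
  by rewrite expr0n expn_eq0 /= addr0.
exists (Q.[0] * mpolyC r l^-1).
have := congr1 (horner^~ 0) cE; rewrite R0 addr0 curve0 => ->.
by rewrite hornerM /A hornerZ curve0 mulrA.
Qed.

End MultivariateEstimates.

(** * Compactness of bounded parts of affine varieties *)

Section Compact.
Variable R : realType.
Notation C := (Cplx R).

Lemma complex_normE (x y : R) : `|(x +i* y)%C : C| = (Num.sqrt (x ^+ 2 + y ^+ 2))%:C%C.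
Proof. by []. Qed.

Lemma complex_pair_continuous : continuous (fun p : R * R => (p.1 +i* p.2)%C : C).
Proof.
move=> [x y]; apply/cvgrPdist_lt => e e0.
have [r r0 er] : exists2 r : R, 0 < r & e = r%:C%C.
  move: e0; case: e => r s; rewrite ltcE /= => /andP[/eqP s0 r0].
  by exists r; rewrite // s0.
have r20 : 0 < r / 2 by lra.
near=> p; rewrite er.
have -> : ((x +i* y)%C : C) - (p.1 +i* p.2)%C = ((x - p.1) +i* (y - p.2))%C by [].
rewrite complex_normE ltcR.
have : `|x - p.1| < r / 2.
  by near: p; exact: (cvgr_dist_lt _ _ (@cvg_fst _ _ (nbhs x) (nbhs y) _) _ r20).
have : `|y - p.2| < r / 2.
  by near: p; exact: (cvgr_dist_lt _ _ (@cvg_snd _ _ (nbhs x) (nbhs y) _) _ r20).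
move: (x - p.1) (y - p.2) => a b; rewrite !ltr_norml => /andP[b1 b2] /andP[a1 a2].
rewrite -[ltRHS](@gtr0_norm _ r) // -sqrtr_sqr ltr_sqrt; first by nra.
by rewrite exprn_gt0.
Unshelve. all: by end_near. Qed.

(** A square is used because compactness comes from intervals of the real line. *)
Lemma disk_sub_compact (M : C) : exists2 K : set C, compact K & forall z, `|z| <= M -> K z.
Proof.
pose a := complex.Re M.
exists ((fun p : R * R => (p.1 +i* p.2)%C : C) @` (`[- a, a] `*` `[- a, a])).
  apply: continuous_compact; last by apply: compact_setX; apply: segment_compact.
  exact/continuous_subspaceT/complex_pair_continuous.
case=> x y; rewrite complex_normE lecE /= -/a => /andP[_ le].
exists (x, y) => //=.
have xy0 : 0 <= x ^+ 2 + y ^+ 2 by rewrite addr_ge0 ?sqr_ge0.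
have a0 : 0 <= a by apply: le_trans le; apply: sqrtr_ge0.
have le2 : x ^+ 2 + y ^+ 2 <= a ^+ 2 by rewrite -(sqr_sqrtr xy0) lerXn2r ?nnegrE ?sqrtr_ge0.
by split; rewrite /= in_itv /=; apply/andP; split; nra.
Qed.

Lemma continuous_sumr (T : topologicalType) (I : Type) (s : seq I) (F : I -> T -> C) :
  (forall i, continuous (F i)) -> continuous (fun x => \sum_(i <- s) F i x).
Proof.
move=> cF; elim: s => [|i s IH].
  by under eq_fun do rewrite big_nil; exact: cst_continuous.
by under eq_fun do rewrite big_cons; move=> x; apply: cvgD; [exact: cF | exact: IH].
Qed.

Lemma continuous_prodr (T : topologicalType) (I : Type) (s : seq I) (F : I -> T -> C) :
  (forall i, continuous (F i)) -> continuous (fun x => \prod_(i <- s) F i x).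
Proof.
move=> cF; elim: s => [|i s IH].
  by under eq_fun do rewrite big_nil; exact: cst_continuous.
by under eq_fun do rewrite big_cons; move=> x; apply: cvgM; [exact: cF | exact: IH].
Qed.

Lemma continuous_expr (T : topologicalType) (F : T -> C) k :
  continuous F -> continuous (fun x => F x ^+ k).
Proof.
move=> cF; elim: k => [|k IH]; first by under eq_fun do rewrite expr0; exact: cst_continuous.
by under eq_fun do rewrite exprS; move=> x; apply: cvgM; [exact: cF | exact: IH].
Qed.

Lemma continuous_addf (T : topologicalType) (F G : T -> C) :
  continuous F -> continuous G -> continuous (fun x => F x + G x).
Proof. by move=> cF cG x; apply: cvgD; [exact: cF | exact: cG]. Qed.

Lemma continuous_mulf (T : topologicalType) (F G : T -> C) :
  continuous F -> continuous G -> continuous (fun x => F x * G x).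
Proof. by move=> cF cG x; apply: cvgM; [exact: cF | exact: cG]. Qed.

Lemma continuous_constf (T : topologicalType) (c : C) : continuous (fun _ : T => c).
Proof. exact: cst_continuous. Qed.

Lemma continuous_normf (T : topologicalType) (F : T -> C) :
  continuous F -> continuous (fun x => `|F x| : C).
Proof. by move=> cF x; apply: cvg_norm; exact: cF. Qed.

Lemma continuous_meval (T : topologicalType) n (u : T -> 'I_n -> C) (p : mpoly n C) :
  (forall i, continuous (fun x => u x i)) -> continuous (fun x => meval (u x) p).
Proof.
move=> cu; under eq_fun do rewrite mevalE.
apply: continuous_sumr => m x; apply: cvgM; first exact: cst_continuous.
by apply: continuous_prodr => i; apply: continuous_expr.
Qed.

Variables (n : nat) (X : set 'rV[C]_n).

Lemma continuous_coord i : continuous (fun x : X => set_val x ord0 i).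
Proof.
move=> x; apply: (@continuous_comp _ _ _ (set_val : X -> 'rV[C]_n) (fun v : 'rV[C]_n => v ord0 i)).
  exact: initial_continuous.
exact: coord_continuous.
Qed.

Lemma zariski_closed_closed (Y : set 'rV[C]_n) : zariski_closed Y -> closed Y.
Proof.
move=> [S ->].
have -> : zero_locus S = \bigcap_(p in S) ((@peval R n p) @^-1` [set 0]).
  by apply/seteqP; split=> x h p Sp; apply: h.
apply: closed_bigI => p _; apply: closed_comp.
  move=> x _; apply: (@continuous_meval 'rV[C]_n n (fun v i => v ord0 i)) => i.
  exact: coord_continuous.
apply: accessible_closed_set1; exact/hausdorff_accessible/norm_hausdorff.
Qed.

(** Uniformity over bounded parts of Y, extracted from compactness: a condition
    that holds near every point for all small e holds for one e > 0. *)
Lemma zariski_closed_near (Y : set 'rV[C]_n) (M : C) (P : C -> X -> Prop) :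
  Y `<=` X -> zariski_closed Y ->
  (forall x : X, Y (set_val x) -> \forall x' \near x & e \near (0 : C), P e x') ->
  exists2 e, 0 < e & forall x : X, Y (set_val x) -> (forall i, `|set_val x ord0 i| <= M) -> P e x.
Proof.
move=> YX Y_closed Pnear.
have [K K_compact KM] := disk_sub_compact M.
have cpt : compact ([set v : 'rV[C]_n | forall i, K (v ord0 i)] `&` Y).
  apply: compact_closedI; last exact: zariski_closed_closed.
  by apply: (@rV_compact C n (fun=> K)).
have cptX : compact [set x : X | (forall i, K (set_val x ord0 i)) /\ Y (set_val x)].
  move=> F FF FK.
  have GK : nbhs ((set_val : X -> _) @ F) ([set v : 'rV[C]_n | forall i, K (v ord0 i)] `&` Y).
    exact: FK.
  have [p [[Kp Yp] clp]] := cpt _ _ GK.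
  have Xp := YX _ Yp.
  exists (exist _ p (mem_set Xp)); split; first by split.
  move=> A B FA [_ [[B' B'o <-] B'p] B'B].
  have Bn : nbhs p B' by apply: open_nbhs_nbhs.
  have An : F ((set_val : X -> 'rV[C]_n) @^-1` (set_val @` A)).
    by apply: (filterS _ FA) => a Aa; exists a.
  have [v [[a Aa <-] B'a]] := clp (set_val @` A) B' An Bn.
  by exists a; split=> //; apply: B'B.
have nc := (compact_near_coveringP _).1 cptX.
have nP : nbhs (0 : C) [set e | [set x : X | (forall i, K (set_val x ord0 i)) /\ Y (set_val x)] `<=` P e].
  by apply: (nc C (nbhs (0 : C)) P) => x [_ Yx]; exact: Pnear.
have [e /= e0 eP] := (nbhs_ballP _ _).1 nP.
exists (e / 2); first by rewrite divr_gt0.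
move=> x Yx Mx; apply: eP; last by split=> // i; apply: KM.
rewrite -ball_normE /= sub0r normrN gtr0_norm ?divr_gt0 // ltr_pdivrMr // ltr_pMr //.
by rewrite ltr1n.
Qed.

Lemma zariski_closed_bounded (Y : set 'rV[C]_n) (M : C) (u : X -> C) :
  Y `<=` X -> zariski_closed Y -> continuous u ->
  exists2 B, 0 <= B & forall x : X, Y (set_val x) ->
    (forall i, `|set_val x ord0 i| <= M) -> `|u x| <= B.
Proof.
move=> YX Y_closed cu.
have [|e e0 eP] := @zariski_closed_near Y M (fun e x => `|e * u x| <= 1) YX Y_closed.
  move=> x Yx; have ux : 0 < `|u x| + 1 by rewrite ltr_wpDl.
  exists ([set x' | `|u x - u x'| < 1], [set e | `|0 - e| < (`|u x| + 1)^-1]).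
    split=> /=; first exact: (cvgr_dist_lt _ _ (cu x) _ ltr01).
    by apply: (@cvgr_dist_lt _ _ _ (nbhs (0 : C)) _ id 0 _ _ _) => //; rewrite invr_gt0.
  move=> [x' e] /= []; rewrite sub0r normrN => ux' le_e.
  rewrite normrM; apply: le_trans (_ : (`|u x| + 1)^-1 * (`|u x| + 1) <= _); last by rewrite mulVf ?gt_eqF.
  apply: ler_pM => //; first exact: ltW.
  rewrite -[u x'](subKr (u x)); apply: le_trans (ler_normB _ _) _.
  by rewrite lerD2l ltW.
exists e^-1; first by rewrite invr_ge0 ltW.
move=> x Yx Mx; have := eP x Yx Mx; rewrite normrM (gtr0_norm e0) => le.
by rewrite -[leRHS]mulr1 mulrC -ler_pdivrMr ?invr_gt0 // invrK mulrC.
Qed.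

Lemma zariski_closed_bounded_below (Y : set 'rV[C]_n) (M : C) (u : X -> C) :
  Y `<=` X -> zariski_closed Y -> continuous u ->
  (forall x : X, Y (set_val x) -> u x != 0) ->
  exists2 e, 0 < e & forall x : X, Y (set_val x) ->
    (forall i, `|set_val x ord0 i| <= M) -> e <= `|u x|.
Proof.
move=> YX Y_closed cu u0.
have [|e e0 eP] := @zariski_closed_near Y M (fun e x => `|e| <= `|u x|) YX Y_closed.
  move=> x Yx; have ux : 0 < `|u x| / 2 by rewrite divr_gt0 // normr_gt0 u0.
  exists ([set x' | `|u x - u x'| < `|u x| / 2], [set e | `|0 - e| < `|u x| / 2]).
    split=> /=; first exact: (cvgr_dist_lt _ _ (cu x) _ ux).
    by apply: (@cvgr_dist_lt _ _ _ (nbhs (0 : C)) _ id 0 _ _ _).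
  move=> [x' e] /= []; rewrite sub0r normrN => ux' le_e.
  have : `|u x| - `|u x'| <= `|u x| / 2 by apply: le_trans (ltW ux'); apply: lerB_dist.
  rewrite lerBlDr => le; apply: le_trans (ltW le_e) _.
  by rewrite -(lerD2l (`|u x| / 2)) -mulrDl -mulr2n -[_ *+ 2]mulr_natr mulfK // pnatr_eq0.
by exists e => // x Yx Mx; have := eP x Yx Mx; rewrite gtr0_norm.
Qed.

End Compact.

(** * Finite projections of an irreducible variety *)

Lemma meval_bounded (C : numClosedFieldType) r (p : mpoly r C) (M : C) : 0 <= M ->
  exists2 B, 0 <= B & forall z : 'I_r -> C, (forall i, `|z i| <= M) -> `|meval z p| <= B.
Proof.
move=> M0; exists (\sum_(m <- msupp p) `|mcoeff m p| * \prod_(i < r) M ^+ m i).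
  by apply: sumr_ge0 => m _; rewrite mulr_ge0 // prodr_ge0 // => i _; rewrite exprn_ge0.
move=> z zM; rewrite mevalE; apply: le_trans (ler_norm_sum _ _ _) _.
apply: ler_sum => m _; rewrite normrM ler_wpM2l // normr_prod.
apply: ler_prod => i _; rewrite normr_ge0 normrX lerXn2r ?nnegrE //.
Qed.

Lemma homogenize_scale (A : comNzRingType) N (a t s : A) (f g : nat -> A) :
  (forall i, f i = a * g i) ->
  a * (\sum_(i < N) g i * t ^+ i * s ^+ (N - i)) = \sum_(i < N) f i * t ^+ i * s ^+ (N - i).
Proof.
by move=> fg; rewrite mulr_sumr; apply: eq_bigr => i _; rewrite fg !mulrA.
Qed.

Lemma homogenizeE (A : comNzRingType) N (k s : A) (c : nat -> A) :
  \sum_(i < N) c i * (s * k) ^+ i * s ^+ (N - i) = s ^+ N * \sum_(i < N) c i * k ^+ i.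
Proof.
rewrite mulr_sumr; apply: eq_bigr => i _.
have -> : s ^+ N = s ^+ i * s ^+ (N - i) by rewrite -exprD subnKC // ltnW.
by rewrite exprMn; ring.
Qed.

(** For each of the finitely many points v <> x with coordinates in l, the equation
    in lam is a nonzero polynomial. *)
Lemma separating_scalar (C : closedFieldType) m (l : seq C) (x : 'I_m -> C) :
  exists lam : C, forall v : 'I_m -> C, (forall i, v i \in l) ->
    \sum_(i < m) lam ^+ i * v i = \sum_(i < m) lam ^+ i * x i -> v =1 x.
Proof.
pose dif (v : 'I_m -> C) : {poly C} := \sum_(i < m) (v i - x i) *: 'X^i.
have difE v (a : C) : (dif v).[a] = \sum_(i < m) a ^+ i * v i - \sum_(i < m) a ^+ i * x i.
  rewrite horner_sum -sumrB; apply: eq_bigr => i _.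
  by rewrite hornerZ hornerXn mulrBl !(mulrC (a ^+ i)).
have dif0 v : dif v = 0 -> v =1 x.
  move=> /polyP d0 i; apply/eqP; rewrite -subr_eq0; apply/eqP.
  rewrite -[RHS](coef0 C i) -d0 coef_sum (bigD1 i) //= coefZ coefXn eqxx mulr1.
  rewrite big1 ?addr0 // => j ji; rewrite coefZ coefXn.
  by rewrite [(i == j :> nat)]eq_sym (inj_eq val_inj) (negPf ji) mulr0.
pose val_of (h : {ffun 'I_m -> seq_sub l}) i := ssval (h i).
have : \prod_(h : {ffun 'I_m -> seq_sub l} | dif (val_of h) != 0) dif (val_of h) != 0.
  by apply/prodf_neq0 => h.
move/closed_nonrootP=> [lam]; rewrite /root horner_prod => /prodf_neq0 lamP.
exists lam => v vl eqv; apply: dif0; apply/eqP/negP => /negP v0.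
pose h : {ffun 'I_m -> seq_sub l} := [ffun i => SeqSub (vl i)].
have hv : dif (val_of h) = dif v.
  by apply: eq_bigr => i _; rewrite /val_of ffunE.
have := lamP h; rewrite hv => /(_ v0); rewrite difE eqv subrr eqxx //.
Qed.

Section Core.
Variables (R : realType) (n : nat).
Notation C := (Cplx R).
Implicit Types (X Y : set 'rV[C]_n).

Definition vanishing Y (p : cpoly R n) : Prop := forall v, Y v -> peval p v = 0.
(** The ideal of Y is proper when prime, so an irreducible set is not empty. *)
Definition irreducible Y := prime_ideal (vanishing Y).

Lemma mem_of_vanishing Y v : zariski_closed Y ->
  (forall p, vanishing Y p -> peval p v = 0) -> Y v.
Proof.
move=> [S YS] vP; rewrite YS => p Sp; apply: vP => w; rewrite YS => Yw; exact: Yw.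
Qed.

Variables (X Y : set 'rV[C]_n).
Hypotheses (YX : Y `<=` X) (Y_closed : zariski_closed Y) (Y_irr : irreducible Y).
Local Notation pt x := (set_val (x : X) : 'rV[C]_n).

Definition proj_pt r (q : 'I_r -> cpoly R n) (v : 'rV[C]_n) : 'I_r -> C := fun j => peval (q j) v.

Definition poly_at r (z : 'I_r -> C) (F : {poly mpoly r C}) : {poly C} := map_poly (meval z) F.

Lemma meval_proj_pt r (q : 'I_r -> cpoly R n) v u :
  meval (proj_pt q v) u = peval (mmap (@mpolyC n C) q u) v.
Proof.
rewrite /peval -[RHS]/((meval (fun i => v ord0 i) : {rmorphism _ -> _}) _) rmorph_mmap.
by apply: eq_mmap => [c|j] //=; rewrite mevalC.
Qed.

(** What the algebra says about a Noether normalization of Y, read on points: it is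
    finite and dominant, and the values over a generic z of a rational function t/s are
    all the roots of its minimal equation at z. *)
Record normalization r (q : 'I_r -> cpoly R n) : Prop := Normalization {
  norm_finite : forall i, exists2 E : {poly mpoly r C}, E \is monic &
    forall v, Y v -> root (poly_at (proj_pt q v) E) (v ord0 i);
  norm_dominant : forall u, (forall v, Y v -> meval (proj_pt q v) u = 0) -> u = 0;
  norm_lift : forall s t, ~ vanishing Y s ->
    exists (F : {poly mpoly r C}) (d : mpoly r C),
    [/\ F != 0, d != 0,
      vanishing Y (\sum_(k < size F) mmap (@mpolyC n C) q F`_k * t ^+ k * s ^+ (size F - k)) &
      forall z tau, meval z d != 0 -> root (poly_at z F) tau ->
        exists v, [/\ Y v, proj_pt q v =1 z, peval s v != 0 & peval s v * tau = peval t v]] }.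

Lemma exists_normalization : exists r (q : 'I_r -> cpoly R n), normalization q.
Proof.
have [r [q [fin [dom lift]]]] := generic_lift Y_irr; exists r, q; split.
- move=> i; have [E E_mon Ex] := fin i; exists E => // v Yv.
  have := Ex v Yv; rewrite /peval -[meval _ _]/((meval (fun i => v ord0 i) : {rmorphism _ -> _}) _).
  rewrite -horner_map -map_poly_comp /= mevalXU => Ev; apply/rootP; rewrite -Ev.
  by congr (_.[_]); apply: eq_map_poly => u /=; rewrite meval_proj_pt.
- by move=> u u0; apply: dom => v Yv; rewrite -meval_proj_pt; apply: u0.
move=> s t s0; have [F [d [F0 d0 rel liftF]]] := lift s t s0; exists F, d; split=> //.
move=> z tau dz /rootP Ftau; have [y [yP yq ys yt]] := liftF z tau dz Ftau.
pose v := \row_i y i : 'rV[C]_n.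
have vE p : peval p v = meval y p.
  by apply: eq_mmap => // i; rewrite mxE.
exists v; split; rewrite ?vE //.
  by apply: mem_of_vanishing => // p Yp; rewrite vE; apply: yP.
by move=> j; rewrite /proj_pt vE.
Qed.

Variables (r : nat) (q : 'I_r -> cpoly R n) (q_norm : normalization q).

(** The coordinates are roots of monic polynomials whose coefficients are
    polynomials in the projection. *)
Lemma fibre_bounded (M : C) : 0 <= M -> exists2 B : C, 0 <= B &
  forall v, Y v -> (forall j, `|proj_pt q v j| <= M) -> forall i, `|v ord0 i| <= B.
Proof.
move=> M0.
have /choice[b bP] : forall i : 'I_n, exists b : C, 0 <= b /\
    forall v, Y v -> (forall j, `|proj_pt q v j| <= M) -> `|v ord0 i| <= b.
  move=> i; have [E E_mon Ev] := norm_finite q_norm i.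
  have /choice[c cP] : forall k : nat, exists c : C, 0 <= c /\
      forall z : 'I_r -> C, (forall j, `|z j| <= M) -> `|meval z E`_k| <= c.
    by move=> k; have [c c0 cz] := meval_bounded E`_k M0; exists c.
  exists (1 + \sum_(k < size E) c k); split.
    by rewrite addr_ge0 // sumr_ge0 // => k _; have [] := cP k.
  move=> v Yv vM; have E_monz : poly_at (proj_pt q v) E \is monic by apply: monic_map.
  apply: le_trans (monic_root_le E_monz (Ev v Yv)) _; rewrite lerD2l.
  rewrite size_map_poly_id0 ?(monicP E_mon) ?rmorph1 ?oner_neq0 //.
  apply: ler_sum => k _; rewrite /poly_at coef_map; have [_] := cP k; exact.
exists (\sum_i b i); first by apply: sumr_ge0 => i _; have [] := bP i.
move=> v Yv vM i; have [b0 bv] := bP i; apply: le_trans (bv v Yv vM) _.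
by rewrite (bigD1 i) //= lerDl sumr_ge0 // => j _; have [] := bP j.
Qed.

Lemma continuous_peval p : continuous (fun x : X => peval p (pt x) : C).
Proof. by apply: continuous_meval => i; apply: continuous_coord. Qed.

Lemma continuous_poly_at (F : {poly mpoly r C}) (k : X -> C) : continuous k ->
  continuous (fun x : X => (poly_at (proj_pt q (pt x)) F).[k x] : C).
Proof.
move=> ck.
have -> : (fun x : X => (poly_at (proj_pt q (pt x)) F).[k x] : C) =
    (fun x : X => \sum_(i < size F) meval (proj_pt q (pt x)) F`_i * k x ^+ i).
  apply: funext => x; rewrite (@horner_coef_wide _ (size F)); last exact: size_poly.
  by apply: eq_bigr => i _; rewrite /poly_at coef_map.
apply: continuous_sumr => i.
have cm : continuous (fun x : X => meval (proj_pt q (pt x)) F`_i : C).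
  by apply: continuous_meval => j; apply: continuous_peval.
exact: continuous_mulf cm (continuous_expr (k := i) ck).
Qed.

(** If no point of Y over z0 were suitable, the continuous function u, which measures
    the failure of the three equations, would be bounded below on the part of Y that
    lies over a neighbourhood of z0.  But a generic z close to z0 has a root of F(z, T)
    close to tau0, and the point above it makes u small.  The function e is carried
    along to record a closed condition satisfied by the generic points. *)
Lemma lift_limit (F : {poly mpoly r C}) d (k e : X -> C) : F \is monic -> d != 0 ->
  continuous k -> continuous e ->
  (forall z tau, meval z d != 0 -> root (poly_at z F) tau ->
     exists x : X, [/\ Y (pt x), proj_pt q (pt x) =1 z, k x = tau & e x = 0]) ->
  forall z tau, root (poly_at z F) tau ->
     exists x : X, [/\ Y (pt x), proj_pt q (pt x) =1 z, k x = tau & e x = 0].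
Proof.
move=> F_mon d0 ck ce gen z0 tau0 root0; apply: contrapT => none.
pose u (x : X) : C := \sum_j `|proj_pt q (pt x) j - z0 j| + (`|k x - tau0| + `|e x|).
have sum0 x : 0 <= \sum_j `|proj_pt q (pt x) j - z0 j| by apply: sumr_ge0.
have u_ge0 x : 0 <= u x by rewrite /u !addr_ge0.
have u0 (x : X) : Y (pt x) -> u x != 0.
  move=> Yx; apply/eqP => /eqP; rewrite /u paddr_eq0 ?addr_ge0 // paddr_eq0 //.
  rewrite !normr_eq0 subr_eq0 psumr_eq0 // => /and3P[/allP zx /eqP kx /eqP ex].
  apply: none; exists x; split=> // j; have := zx j (mem_index_enum _).
  by rewrite /= normr_eq0 subr_eq0 => /eqP.
have cdist (g : X -> C) c : continuous g -> continuous (fun x => `|g x - c| : C).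
  move=> cg; apply: continuous_normf.
  apply: continuous_addf.
  exact: cg.
  exact: continuous_constf.
have cu : continuous u.
  apply: continuous_addf.
    by apply: continuous_sumr => j; apply: cdist; apply: continuous_peval.
  by apply: continuous_addf; [apply: cdist | apply: continuous_normf].
(* Bounds the curve through z0 for |w| <= 1. *)
pose M : C := \sum_j (`|z0 j| + 1).
have M0 : 0 <= M by apply: sumr_ge0 => j _; rewrite addr_ge0.
have [B B0 fibB] := fibre_bounded M0.
have [eps eps0 epsP] := zariski_closed_bounded_below B YX Y_closed cu u0.
pose N := (msize d).+1.
pose eps1 : C := eps / (r.+1)%:R.
have eps1_0 : 0 < eps1 by rewrite divr_gt0 // ltr0n.
(* h <= 1 makes h^(D + 1) a common bound for h^D and h. *)
pose h : C := eps1 / (1 + eps1).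
have h0 : 0 < h by rewrite divr_gt0 // addr_gt0.
have h1 : h <= 1 by rewrite ler_pdivrMr ?addr_gt0 // mul1r lerDr.
have h_eps : h <= eps1.
  by rewrite ler_pdivrMr ?addr_gt0 // ler_peMr ?ltW // ltrDl.
pose D := (size F).-1.
pose Pw : {poly C} := \sum_(i < size F) map_poly (meval z0) (along_curve N F`_i) * (tau0 ^+ i)%:P.
have PwE w : Pw.[w] = (poly_at (curve N z0 w) F).[tau0].
  rewrite /Pw horner_sum (@horner_coef_wide _ (size F)); last exact: size_poly.
  apply: eq_bigr => i _; rewrite hornerM hornerC /poly_at coef_map; congr (_ * _).
  exact: meval_curve.
have curve_at0 : curve N z0 0 =1 z0.
  by move=> j; rewrite /curve expr0n expn_eq0 /= addr0.
have d'0 : map_poly (meval z0) (along_curve N d) != 0.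
  by apply: along_curve_map_neq0 => //; apply: leqnSn.
pose mon (j : 'I_r) : {poly C} := 'X^(N ^ j).
pose fam := Pw :: 'X :: [seq mon j | j <- enum 'I_r].
have [||w dw small] := @poly_common_small _ fam _ (h ^+ D.+1) _ _ d'0.
- move=> p; rewrite !inE => /or3P[/eqP->|/eqP->|/mapP[j _ ->]].
  + rewrite PwE; move/rootP: root0; congr (_ = _); congr (_.[_]).
    by apply: eq_map_poly => p'; apply: meval_eq => j; rewrite curve_at0.
  + by rewrite hornerX.
  + by rewrite hornerXn expr0n expn_eq0.
- by rewrite exprn_gt0.
have h_ge0 := ltW h0.
have hD : h ^+ D.+1 <= h by rewrite exprS ler_piMr // exprn_ile1.
have hD' : h ^+ D.+1 <= h ^+ D by rewrite exprS ler_piMl // exprn_ge0.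
have w1 : `|w| <= 1.
  have := small 'X; rewrite hornerX !inE eqxx orbT => /(_ isT) /ltW lew.
  exact: le_trans lew (le_trans hD h1).
have wj (j : 'I_r) : `|w ^+ (N ^ j)| < h.
  have := small (mon j); rewrite hornerXn !inE map_f ?mem_enum ?orbT // => /(_ isT) lt.
  exact: lt_le_trans lt hD.
set z := curve N z0 w.
have Fz_mon : poly_at z F \is monic by apply: monic_map.
have [|tau Ftau tau_near] := @root_near _ (poly_at z F) tau0 h Fz_mon h0.
  have -> : size (poly_at z F) = size F.
    by rewrite size_map_poly_id0 // (monicP F_mon) rmorph1 oner_neq0.
  rewrite -PwE; have := small Pw; rewrite inE eqxx => /(_ isT) lt.
  exact: lt_le_trans lt hD'.
have [|x [Yx xz kx ex]] := gen z tau _ Ftau.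
  by rewrite -meval_curve.
have xB i : `|pt x ord0 i| <= B.
  apply: fibB => // j; rewrite xz; apply: le_trans (curve_norm_le _ _ _ w1) _.
  by apply: ler_sum => i' _; rewrite expr1n.
have := epsP x Yx xB; rewrite ger0_norm //; apply/negP; rewrite lt_geF //.
rewrite /u kx ex normr0 addr0.
have -> : eps = \sum_(j < r) eps1 + eps1.
  by rewrite sumr_const card_ord -mulrSr -mulr_natr divfK // pnatr_eq0.
apply: ler_ltD; last exact: lt_le_trans h_eps.
apply: ler_sum => j _; rewrite xz /z /curve addrC addKr.
by apply/ltW; apply: lt_le_trans h_eps.
Qed.

(** Over a bounded set of generic z all roots of the minimal equation are values of k
    on a compact set, so the coefficients are bounded multiples of the
    leading one, which therefore divides them. *)
Lemma generic_equation (s t : cpoly R n) (k : X -> C) : ~ vanishing Y s -> continuous k ->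
  (forall x : X, Y (pt x) -> peval s (pt x) * k x = peval t (pt x)) ->
  exists (F : {poly mpoly r C}) (d : mpoly r C),
  [/\ F \is monic, d != 0,
    forall x : X, Y (pt x) -> peval s (pt x) != 0 -> root (poly_at (proj_pt q (pt x)) F) (k x) &
    forall z tau, meval z d != 0 -> root (poly_at z F) tau ->
      exists x : X, [/\ Y (pt x), proj_pt q (pt x) =1 z, peval s (pt x) != 0 & k x = tau]].
Proof.
move=> s0 ck stk; have [F [d [F0 d0 rel liftF]]] := norm_lift q_norm t s0.
pose a := lead_coef F; have a0 : a != 0 by rewrite lead_coef_eq0.
have lift z tau : meval z d != 0 -> root (poly_at z F) tau ->
    exists x : X, [/\ Y (pt x), proj_pt q (pt x) =1 z, peval s (pt x) != 0 & k x = tau].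
  move=> dz Fz; have [v [Yv vz sv svt]] := liftF z tau dz Fz.
  pose x : X := exist _ v (mem_set (YX Yv)); exists x; split=> //.
  by apply: (mulfI sv); rewrite svt; apply: (stk x).
have da0 : d * a != 0 by rewrite mulf_neq0.
have /choice[m mP] : forall i, exists m, F`_i = m * a.
  move=> i; apply: (bounded_quotient a0 da0) => M M0.
  have [B B0 fibB] := fibre_bounded M0.
  have [B' B'0 kB] := zariski_closed_bounded B YX Y_closed ck.
  exists ((1 + B') ^+ (size F).-1); first by rewrite exprn_ge0 // addr_ge0.
  move=> z zM; rewrite rmorphM mulf_eq0 negb_or => /andP[dz az].
  have szF : size (poly_at z F) = size F by rewrite size_map_poly_id0.
  have lF : lead_coef (poly_at z F) = meval z a by rewrite lead_coef_map_eq.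
  have := @coef_le_of_roots _ (poly_at z F) B' i B'0.
  rewrite szF lF /poly_at coef_map; apply=> tau Ftau.
  have [x [Yx xz sx <-]] := lift z tau dz Ftau.
  by apply: kB => // j; apply: fibB => // l; rewrite xz.
have [G FG] : exists G, F = a *: G.
  exists (\poly_(i < size F) m i); apply/polyP => i; rewrite coefZ coef_poly.
  case: ltnP => [_|le]; first by rewrite mP mulrC.
  by rewrite nth_default // mulr0.
have G_mon : G \is monic.
  have := congr1 (@lead_coef _) FG; rewrite lead_coefZ -/a -[LHS]mulr1 => /(mulfI a0) lG.
  by rewrite monicE -lG.
exists G, (d * a); split=> //; last first.
  move=> z tau; rewrite rmorphM mulf_eq0 negb_or => /andP[dz az] Gz; apply: lift => //.
  by rewrite /poly_at FG map_polyZ rootZ.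
have szFG : size F = size G by rewrite FG size_scale.
move=> x Yx sx.
pose H := \sum_(i < size G) mmap (@mpolyC n C) q G`_i * t ^+ i * s ^+ (size G - i).
have HE : mmap (@mpolyC n C) q a * H =
    \sum_(i < size F) mmap (@mpolyC n C) q F`_i * t ^+ i * s ^+ (size F - i).
  rewrite szFG; apply: (@homogenize_scale _ _ _ _ _
    (fun i => mmap (@mpolyC n C) q F`_i) (fun i => mmap (@mpolyC n C) q G`_i)).
  move=> i; have -> : F`_i = a * G`_i by rewrite FG coefZ.
  exact: rmorphM.
have relH : vanishing Y (mmap (@mpolyC n C) q a * H) by rewrite HE.
have [_ _ Y_prime] := Y_irr.
have [av|Hv] := Y_prime _ _ relH.
  case/eqP: a0; apply: (norm_dominant q_norm) => v Yv.
  by rewrite meval_proj_pt; apply: av.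
have := Hv _ Yx; rewrite /peval -[meval _ _]/((meval (fun i => pt x ord0 i) : {rmorphism _ -> _}) _).
rewrite rmorph_sum => H0.
have : peval s (pt x) ^+ size G * (poly_at (proj_pt q (pt x)) G).[k x] = 0.
  rewrite (@horner_coef_wide _ (size G)); last exact: size_poly.
  rewrite -(homogenizeE _ _ _ (fun i => (poly_at (proj_pt q (pt x)) G)`_i)).
  apply: etrans H0; apply: eq_bigr => i _; rewrite stk // /poly_at coef_map.
  by rewrite !rmorphM !rmorphXn; congr (_ * _ * _); exact: meval_proj_pt.
by move/eqP; rewrite mulf_eq0 expf_eq0 (negPf sx) andbF.
Qed.

Definition poly_pt (v : 'rV[C]_n) (Q : {poly cpoly R n}) : {poly C} :=
  map_poly (meval (fun i => v ord0 i)) Q.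

Lemma poly_pt_pullback v (F : {poly mpoly r C}) :
  poly_pt v (map_poly (mmap (@mpolyC n C) q) F) = poly_at (proj_pt q v) F.
Proof.
rewrite /poly_pt /poly_at -map_poly_comp; apply: eq_map_poly => u /=.
by rewrite meval_proj_pt.
Qed.

Lemma fibre_coordinates (z : 'I_r -> C) : exists l : seq C, forall v, Y v ->
  proj_pt q v =1 z -> forall i, v ord0 i \in l.
Proof.
have /choice[l lP] : forall i, exists l : seq C, forall v, Y v -> proj_pt q v =1 z -> v ord0 i \in l.
  move=> i; have [E E_mon Ev] := norm_finite q_norm i.
  have Ez_mon : poly_at z E \is monic by apply: monic_map.
  have [l lE] := closed_field_poly_normal (poly_at z E); exists l => v Yv vz.
  have : root (poly_at z E) (v ord0 i).
    have -> : poly_at z E = poly_at (proj_pt q v) E.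
      by apply: eq_map_poly => u; apply: meval_eq => j; rewrite vz.
    exact: Ev.
  by rewrite lE (monicP Ez_mon) scale1r root_prod_XsubC.
exists (flatten [seq l i | i <- enum 'I_n]) => v Yv vz i.
apply/flattenP; exists (l i); last exact: lP.
by apply: map_f; rewrite mem_enum.
Qed.

Lemma linear_form (lam : C) : exists g : cpoly R n,
  forall v, peval g v = \sum_(i < n) lam ^+ i * v ord0 i.
Proof.
exists (\sum_(i < n) mpolyC n (lam ^+ i) * mpolyX C (mnm1 i)) => v.
rewrite /peval -[LHS]/((meval (fun i => v ord0 i) : {rmorphism _ -> _}) _) rmorph_sum.
by apply: eq_bigr => i _; rewrite rmorphM /= mevalC mevalXU.
Qed.

(** The locus s <> 0 is dense in Y for the Euclidean topology.  A linear
    form g separating x0 from the other points of its fibre satisfies an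
    equation whose root (q(x0), g(x0)) is, by [lift_limit], the image of a limit of
    points with s <> 0; only x0 itself can be that limit. *)
Lemma dense_vanishing (s : cpoly R n) (e : X -> C) : ~ vanishing Y s -> continuous e ->
  (forall x : X, Y (pt x) -> peval s (pt x) != 0 -> e x = 0) ->
  forall x : X, Y (pt x) -> e x = 0.
Proof.
move=> s0 ce es x0 Yx0.
have [l lP] := fibre_coordinates (proj_pt q (pt x0)).
have [lam sep] := separating_scalar l (fun i => pt x0 ord0 i).
have [g gE] := linear_form lam.
have [||F [d [F_mon d0 rootF liftF]]] := @generic_equation s (s * g) (fun x => peval g (pt x)) s0.
- exact: continuous_peval.
- by move=> x _; rewrite /peval mevalM.
pose H : cpoly R n := (map_poly (mmap (@mpolyC n C) q) F).[g].
have HE v : peval H v = (poly_at (proj_pt q v) F).[peval g v].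
  rewrite -poly_pt_pullback /poly_pt /peval /H.
  by rewrite -[LHS]/((meval (fun i => v ord0 i) : {rmorphism _ -> _}) _) -horner_map.
have sH : vanishing Y (s * H).
  move=> v Yv; rewrite /peval mevalM -![meval _ _]/(peval _ v) HE.
  have [->|sv] := eqVneq (peval s v) 0; first by rewrite mul0r.
  pose x : X := exist _ v (mem_set (YX Yv)).
  by have /rootP -> := rootF x Yv sv; rewrite mulr0.
have [_ _ Y_prime] := Y_irr; have [//|HY] := Y_prime _ _ sH.
have root0 : root (poly_at (proj_pt q (pt x0)) F) (peval g (pt x0)).
  by apply/rootP; rewrite -HE; apply: HY.
have gen z tau : meval z d != 0 -> root (poly_at z F) tau ->
    exists x : X, [/\ Y (pt x), proj_pt q (pt x) =1 z, peval g (pt x) = tau & e x = 0].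
  move=> dz Fz; have [x [Yx xz sx gx]] := liftF z tau dz Fz; exists x; split=> //.
  exact: es.
have [x [Yx xz gx ex]] :=
  @lift_limit F d _ e F_mon d0 (@continuous_peval g) ce gen _ _ root0.
suff -> : x0 = x by [].
apply: val_inj; apply/rowP => i; apply/esym.
have := sep (fun i => pt x ord0 i) (lP _ Yx xz); rewrite -!gE gx => /(_ erefl i).
by [].
Qed.

Lemma integral_equation (s t : cpoly R n) (k : X -> C) : ~ vanishing Y s -> continuous k ->
  (forall x : X, Y (pt x) -> peval s (pt x) * k x = peval t (pt x)) ->
  exists F : {poly mpoly r C},
  [/\ F \is monic,
    forall x : X, Y (pt x) -> root (poly_at (proj_pt q (pt x)) F) (k x) &
    forall z tau, root (poly_at z F) tau ->
      exists x : X, [/\ Y (pt x), proj_pt q (pt x) =1 z & k x = tau]].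
Proof.
move=> s0 ck stk; have [F [d [F_mon d0 rootF liftF]]] := generic_equation s0 ck stk.
exists F; split=> //.
  have es (y : X) : Y (pt y) -> peval s (pt y) != 0 -> (poly_at (proj_pt q (pt y)) F).[k y] = 0.
    by move=> Yy sy; apply/rootP; apply: rootF.
  by move=> x Yx; apply/rootP; exact: (dense_vanishing s0 (@continuous_poly_at F k ck) es Yx).
move=> z tau Fz.
have gen w sg : meval w d != 0 -> root (poly_at w F) sg ->
    exists x : X, [/\ Y (pt x), proj_pt q (pt x) =1 w, k x = sg & (0 : C) = 0].
  by move=> dw Fw; have [x [Yx xw _ kx]] := liftF w sg dw Fw; exists x.
have [x [Yx xz kx _]] :=
  @lift_limit F d k (fun=> 0) F_mon d0 ck (@continuous_constf R X 0) gen z tau Fz.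
by exists x.
Qed.

(** Let k be a combination of the coordinates and f that separates (v0, c) from the
    points of the graph over q(v0), which are finitely many because the coordinates and
    f are integral over C[z].  Pulled back to the variables x and T, the equation of k
    vanishes on the graph, hence at (v0, c): so some point of the graph over q(v0)
    has the same value of k. *)
Lemma graph_closed_over (s t : cpoly R n) (f : X -> C) : ~ vanishing Y s -> continuous f ->
  (forall x : X, Y (pt x) -> peval s (pt x) * f x = peval t (pt x)) ->
  forall (v0 : 'rV[C]_n) (c : C),
  (forall Q : {poly cpoly R n}, (forall x : X, Y (pt x) -> root (poly_pt (pt x) Q) (f x)) ->
     root (poly_pt v0 Q) c) ->
  exists x : X, [/\ Y (pt x), pt x = v0 & f x = c].
Proof.
move=> s0 cf stf v0 c clos.
have Yv0 : Y v0.
  apply: mem_of_vanishing => // p Yp; have := clos p%:P.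
  rewrite /poly_pt map_polyC /= rootC => /(_ _)/eqP; apply=> x Yx.
  by rewrite /poly_pt map_polyC rootC; apply/eqP/Yp.
have [Ff [Ff_mon rootFf _]] := integral_equation s0 cf stf.
set z := proj_pt q v0.
have [l lP] := fibre_coordinates z.
have Ffz_mon : poly_at z Ff \is monic by apply: monic_map.
have [lf lfE] := closed_field_poly_normal (poly_at z Ff).
(* The point (v, a) of affine (n+1)-space. *)
pose coords (v : 'rV[C]_n) (a : C) (i : 'I_n.+1) : C :=
  if unlift ord_max i is Some j then v ord0 j else a.
have [lam sep] := separating_scalar (l ++ lf) (coords v0 c).
have sumE v a : \sum_(i < n.+1) lam ^+ i * coords v a i =
    \sum_(i < n) lam ^+ i * v ord0 i + lam ^+ n * a.
  rewrite big_ord_recr /= /coords unlift_none; congr (_ + _); apply: eq_bigr => i _.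
  have -> : widen_ord (leqnSn n) i = lift ord_max i by apply: val_inj; rewrite /= /bump leqNgt ltn_ord.
  by rewrite liftK.
have [g gE] := linear_form lam.
pose k (x : X) : C := peval g (pt x) + lam ^+ n * f x.
have [||F [F_mon rootF liftF]] := @integral_equation s (s * g + mpolyC n (lam ^+ n) * t) k s0.
- exact: continuous_addf (@continuous_peval g) (continuous_mulf (@continuous_constf R X (lam ^+ n)) cf).
- move=> x Yx; rewrite /k /peval mevalD !mevalM mevalC -![meval _ _]/(peval _ (pt x)) -stf //.
  by rewrite mulrDr mulrCA.
pose Q : {poly cpoly R n} := map_poly (mmap (@mpolyC n C) q) F \Po (g%:P + mpolyC n (lam ^+ n) *: 'X).
have QE v a : (poly_pt v Q).[a] = (poly_at (proj_pt q v) F).[peval g v + lam ^+ n * a].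
  rewrite /Q /poly_pt map_comp_poly -/(poly_pt v _) -poly_pt_pullback horner_comp; congr (_.[_]).
  rewrite /poly_pt rmorphD /= map_polyC map_polyZ map_polyX /= hornerD hornerC hornerZ hornerX mevalC.
  by [].
have [|x [Yx xz kx]] := liftF z (peval g v0 + lam ^+ n * c).
  apply/rootP; rewrite -QE; apply/rootP/clos => x Yx; apply/rootP; rewrite QE.
  by apply/rootP/rootF.
have root_f : f x \in lf.
  rewrite -root_prod_XsubC -[\prod_(_ <- _) _]scale1r -(monicP Ffz_mon) -lfE.
  have -> : poly_at z Ff = poly_at (proj_pt q (pt x)) Ff.
    by apply: eq_map_poly => u; apply: meval_eq => j; rewrite xz.
  exact: rootFf.
have eq_coords : coords (pt x) (f x) =1 coords v0 c.
  apply: sep => [i|]; last by rewrite !sumE -!gE.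
  rewrite mem_cat /coords; case: unliftP => [j _|_]; last by rewrite root_f orbT.
  by rewrite (lP _ Yx xz).
exists x; split=> //; last by have := eq_coords ord_max; rewrite /coords unlift_none.
by apply/rowP => i; have := eq_coords (lift ord_max i); rewrite /coords liftK.
Qed.

End Core.

(** * Irreducible decomposition *)

Section Decomposition.
Variables (R : realType) (n : nat).
Notation C := (Cplx R).
Implicit Types (X Y : set 'rV[C]_n) (p q : cpoly R n).

Lemma pevalM p q v : peval (p * q) v = peval p v * peval q v :> C.
Proof. exact: mevalM. Qed.
Lemma pevalD p q v : peval (p + q) v = peval p v + peval q v :> C.
Proof. exact: mevalD. Qed.
Lemma peval1 v : peval (1 : cpoly R n) v = 1 :> C.
Proof. exact: meval1. Qed.
Lemma peval0 v : peval (0 : cpoly R n) v = 0 :> C.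
Proof. exact: meval0. Qed.

Lemma vanishing_ideal Y : ideal (vanishing (R := R) Y).
Proof.
split; first by move=> v _; apply: peval0.
  by move=> p q Yp Yq v Yv; rewrite pevalD Yp // Yq // addr0.
by move=> p q Yq v Yv; rewrite pevalM Yq // mulr0.
Qed.

Lemma zariski_closed_locus Y p : zariski_closed Y ->
  zariski_closed (Y `&` [set v | peval p v = 0]).
Proof.
move=> [S ->]; exists (S `|` [set p]); apply/seteqP; split=> v.
  by move=> [Sv pv] q [/Sv//|->].
by move=> Spv; split=> [q Sq|]; apply: Spv; [left | right].
Qed.

Lemma zariski_closedU X Y : zariski_closed X -> zariski_closed Y -> zariski_closed (X `|` Y).
Proof.
move=> [S ->] [T ->]; exists [set pq | exists p q, [/\ S p, T q & pq = p * q]].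
apply/seteqP; split=> v.
  by move=> [Sv|Tv] _ [p [q [Sp Tq ->]]]; rewrite pevalM; [rewrite (Sv p Sp) mul0r | rewrite (Tv q Tq) mulr0].
move=> STv; apply: contrapT => /not_orP[/existsNP[p /not_implyP[Sp pv]] /existsNP[q /not_implyP[Tq qv]]].
have /eqP : peval (p * q) v = 0 :> C by apply: STv; exists p, q.
by rewrite pevalM mulf_eq0 => /orP[] /eqP.
Qed.

Lemma zariski_closed0 : zariski_closed (set0 : set 'rV[C]_n).
Proof.
exists [set 1]; apply/seteqP; split=> v // /(_ 1 erefl)/eqP.
by rewrite peval1 oner_eq0.
Qed.

Definition decomposable X := exists k (Ys : 'I_k -> set 'rV[C]_n),
  (forall i, zariski_closed (Ys i) /\ irreducible (Ys i)) /\ X = \bigcup_i Ys i.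

Lemma decomposableU X Y : decomposable X -> decomposable Y -> decomposable (X `|` Y).
Proof.
move=> [k [Xs [Xs_irr ->]]] [l [Ys [Ys_irr ->]]].
exists (k + l)%N, (fun i => match fintype.split i with inl a => Xs a | inr b => Ys b end); split.
  by move=> i; case: (fintype.split i).
apply/seteqP; split=> v.
  move=> [[i _ Xv]|[i _ Yv]]; first by exists (lshift l i); rewrite // (unsplitK (inl i)).
  by exists (rshift k i); rewrite // (unsplitK (inr i)).
by move=> [i _]; case: (fintype.split i) => a av; [left | right]; exists a.
Qed.

Lemma not_decomposable Y : zariski_closed Y -> ~ decomposable Y ->
  exists2 p, ~ vanishing Y p & ~ decomposable (Y `&` [set v | peval p v = 0]).
Proof.
move=> Y_closed nY.
have nirr : ~ irreducible Y.
  move=> Y_irr; apply: nY; exists 1%N, (fun=> Y); split=> //.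
  by apply/seteqP; split=> [v Yv|v [_ _ Yv]] //; exists ord0.
have Y1 : ~ vanishing Y 1.
  move=> Y1; apply: nY; exists 0%N, (fun=> set0); split=> [[]//|].
  apply/seteqP; split=> v; last by move=> [[]].
  by move=> /Y1/eqP; rewrite peval1 oner_eq0.
apply: contrapT => no; apply: nirr; split=> //; first exact: vanishing_ideal.
move=> p q pq; apply: contrapT => /not_orP[np nq]; apply: no.
have [decp|ndecp] := pselect (decomposable (Y `&` [set v | peval p v = 0])); last by exists p.
have [decq|ndecq] := pselect (decomposable (Y `&` [set v | peval q v = 0])); last by exists q.
case: nY; have -> : Y = (Y `&` [set v | peval p v = 0]) `|` (Y `&` [set v | peval q v = 0]).
  apply/seteqP; split=> v; last by move=> [] [].
  by move=> Yv; have /eqP := pq v Yv; rewrite pevalM mulf_eq0 => /orP[] /eqP; [left|right].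
exact: decomposableU.
Qed.

(** Otherwise repeated cutting gives a decreasing sequence of closed sets and
    polynomials p_k that vanish on all later sets but not on the k-th one, so
    that no p_m is a combination of its predecessors. *)
Theorem irreducible_decomposition X : zariski_closed X -> decomposable X.
Proof.
move=> X_closed; apply: contrapT => nX.
have /choice[p pP] : forall Y, exists p, zariski_closed Y -> ~ decomposable Y ->
    ~ vanishing Y p /\ ~ decomposable (Y `&` [set v | peval p v = 0]).
  move=> Y; have [Yc|nYc] := pselect (zariski_closed Y); last by exists 0.
  have [dY|ndY] := pselect (decomposable Y); first by exists 0.
  by have [p Yp Yp'] := not_decomposable Yc ndY; exists p.
pose Ys := fix Ys k := if k is k'.+1 then Ys k' `&` [set v | peval (p (Ys k')) v = 0] else X.
have YsP k : zariski_closed (Ys k) /\ ~ decomposable (Ys k).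
  elim: k => [|k [IHc IHd]] //=; split; first exact: zariski_closed_locus.
  by have [] := pP _ IHc IHd.
have Ys_decr k l : (k <= l)%N -> Ys l `<=` Ys k.
  move=> /subnK <-; elim: (l - k)%N => [|i IH] v //= [Yv _]; exact: IH.
have [m [c _ eqm]] := @mpoly_noetherian C n (fun k => p (Ys k)) (fun=> I).
have [Yc Yd] := YsP m; have [+ _] := pP _ Yc Yd; apply=> v Yv.
rewrite eqm /peval -[meval _ _]/((meval (fun i => v ord0 i) : {rmorphism _ -> _}) _) rmorph_sum big1 // => i _.
have [_ pv] := Ys_decr i.+1 m (ltn_ord i) v Yv.
by rewrite rmorphM -[X in _ * X]/(peval _ v) pv mulr0.
Qed.

End Decomposition.

(** * Integrality and closed graph *)

Section Global.
Variables (R : realType) (n : nat) (X : set 'rV[Cplx R]_n).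
Hypothesis X_closed : zariski_closed X.
Variables (f : X -> Cplx R) (f_K0 : K0 X f).
Notation C := (Cplx R).
Local Notation pt x := (set_val (x : X) : 'rV[C]_n).

Definition rational_over (Y : set 'rV[C]_n) := exists s t : cpoly R n,
  ~ vanishing Y s /\ forall x : X, Y (pt x) -> peval s (pt x) * f x = peval t (pt x).

(** Components that miss the domain U of f can be dropped: the complement of
    the union of the others is Zariski open and misses U, hence is empty by density. *)
Lemma rational_cover : exists k (Ys : 'I_k -> set 'rV[C]_n),
  (forall i, [/\ zariski_closed (Ys i), irreducible (Ys i), Ys i `<=` X & rational_over (Ys i)])
  /\ X `<=` \bigcup_i Ys i.
Proof.
have [k [Ys [YsP XE]]] := irreducible_decomposition X_closed.
have XYs v : X v -> exists i, Ys i v by rewrite {1}XE => -[i _ Yv]; exists i.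
have YsX i v : Ys i v -> X v by move=> Yv; rewrite XE; exists i.
have [[U [U_open U_dense U_reg]] _] := f_K0.
pose good i := `[< rational_over (Ys i) >].
have good_of_U i (x : X) : Ys i (pt x) -> U x -> good i.
  move=> Yx /U_reg[p [q [W [[S WE] Wx WU Wf]]]]; apply/asboolP.
  have /existsNP[h /not_implyP[Sh hx]] : ~ zero_locus S (pt x) by rewrite WE in Wx.
  have [qx _] := Wf x Wx.
  exists (h * q), (h * p); split.
    move=> /(_ (pt x) Yx)/eqP; rewrite pevalM mulf_eq0 (negPf qx) orbF => /eqP; exact: hx.
  move=> y Yy; rewrite !pevalM; have [->|hy] := eqVneq (peval h (pt y)) 0; first by rewrite !mul0r.
  have Wy : W y by rewrite WE => /(_ h Sh)/eqP; rewrite (negPf hy).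
  have [qy ->] := Wf y Wy; rewrite -mulrA; congr (_ * _); by rewrite mulrC divfK.
have closed_good : zariski_closed (\bigcup_(i in [set i | good i]) Ys i).
  suff : forall s : seq 'I_k, zariski_closed (\bigcup_(i in [set i | i \in s /\ good i]) Ys i).
    move=> h; rewrite (_ : [set i | good i] = [set i | i \in enum 'I_k /\ good i]); first exact: h.
    by apply/seteqP; split=> i /= => [gi|[]//]; split=> //; rewrite mem_enum.
  elim=> [|i s IH].
    have -> : \bigcup_(i in [set i | i \in [::] /\ good i]) Ys i = set0.
      by apply/seteqP; split=> v // [i []].
    exact: zariski_closed0.
  have [gi|ngi] := boolP (good i).
    have -> : \bigcup_(j in [set j | j \in i :: s /\ good j]) Ys j =
        Ys i `|` \bigcup_(j in [set j | j \in s /\ good j]) Ys j.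
      apply/seteqP; split=> v.
        by move=> [j /= []]; rewrite inE => /orP[/eqP->|js] gj Yv; [left | right; exists j].
      move=> [Yv|[j [js gj] Yv]]; first by exists i => //=; rewrite mem_head.
      by exists j => //=; rewrite inE js orbT.
    by apply: zariski_closedU => //; have [] := YsP i.
  have -> : \bigcup_(j in [set j | j \in i :: s /\ good j]) Ys j =
      \bigcup_(j in [set j | j \in s /\ good j]) Ys j; last exact: IH.
  apply/seteqP; split=> v.
    move=> [j /= []]; rewrite inE => /orP[/eqP->|js] gj Yv; first by rewrite gj in ngi.
    by exists j.
  by move=> [j [js gj] Yv]; exists j => //=; rewrite inE js orbT.
have cover : X `<=` \bigcup_(i in [set i | good i]) Ys i.
  move=> v Xv; apply: contrapT => nv; have [S SE] := closed_good.
  pose x : X := exist _ v (mem_set Xv).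
  have [|y [Vy Uy]] := U_dense (~` [set x : X | zero_locus S (pt x)]) (ex_intro _ S erefl).
    by exists x => /=; rewrite -SE.
  have : X (pt y) by apply: set_mem; exact: (valP y).
  move=> /XYs[i Yy]; apply: Vy; rewrite /= -SE; exists i => //.
  exact: good_of_U Yy Uy.
pose T : finType := {i : 'I_k | good i}.
exists #|T|, (fun j => Ys (val (enum_val j : T))); split.
  move=> j; have [Yc Yi] := YsP (val (enum_val j : T)).
  split=> //; first by move=> v; apply: YsX.
  exact/asboolP/(valP (enum_val j)).
move=> v /cover[i gi Yv]; exists (enum_rank (exist _ i gi : T)) => //.
by rewrite enum_rankK.
Qed.

Lemma poly_ptM v (P Q : {poly cpoly R n}) :
  poly_pt v (P * Q) = poly_pt v P * poly_pt v Q :> {poly C}.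
Proof. exact: rmorphM. Qed.

Lemma poly_ptD v (P Q : {poly cpoly R n}) :
  poly_pt v (P + Q) = poly_pt v P + poly_pt v Q :> {poly C}.
Proof. exact: rmorphD. Qed.

Lemma poly_pt_prod v k (P : 'I_k -> {poly cpoly R n}) :
  poly_pt v (\prod_i P i) = \prod_i poly_pt v (P i) :> {poly C}.
Proof. exact: rmorph_prod. Qed.

(** The product of the equations over the pieces of [rational_cover]. *)
Theorem integral_over_ring : exists2 G : {poly cpoly R n}, G \is monic &
  forall x : X, root (poly_pt (pt x) G) (f x).
Proof.
have [k [Ys [YsP cover]]] := rational_cover; have [_ cf] := f_K0.
have /choice[G GP] : forall i, exists G : {poly cpoly R n}, G \is monic /\
    forall x : X, Ys i (pt x) -> root (poly_pt (pt x) G) (f x).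
  move=> i; have [Yc Yi YX [s [t [s0 stf]]]] := YsP i.
  have [r [q q_norm]] := exists_normalization Yc Yi.
  have [F [F_mon rootF _]] := integral_equation YX Yc Yi q_norm s0 cf stf.
  exists (map_poly (mmap (@mpolyC n C) q) F); split; first exact: monic_map.
  by move=> x Yx; rewrite poly_pt_pullback; apply: rootF.
exists (\prod_i G i).
  by rewrite monic_prod // => i _; have [] := GP i.
move=> x; have [i _ Yx] : (\bigcup_i Ys i) (pt x) by apply/cover/set_mem; exact: (valP x).
rewrite poly_pt_prod (bigD1 i) //= rootM; apply/orP; left.
by have [_] := GP i; apply.
Qed.

(** A point off the graph is separated from the graph over each piece by a polynomial;
    the product of these polynomials separates it from the whole graph. *)
Theorem graph_closed v0 c :
  (forall Q : {poly cpoly R n}, (forall x : X, root (poly_pt (pt x) Q) (f x)) ->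
     root (poly_pt v0 Q) c) ->
  exists2 x : X, pt x = v0 & f x = c.
Proof.
move=> clos; apply: contrapT => none.
have [k [Ys [YsP cover]]] := rational_cover; have [_ cf] := f_K0.
have /choice[Q QP] : forall i, exists Q : {poly cpoly R n}, ~~ root (poly_pt v0 Q) c /\
    forall x : X, Ys i (pt x) -> root (poly_pt (pt x) Q) (f x).
  move=> i; have [Yc Yi YX [s [t [s0 stf]]]] := YsP i.
  have [r [q q_norm]] := exists_normalization Yc Yi.
  apply: contrapT => no; apply: none.
  have [Q Qx|x [Yx xv fx]] := graph_closed_over YX Yc Yi q_norm s0 cf stf (v0 := v0) (c := c).
    by apply: contrapT => /negP nQ; apply: no; exists Q.
  by exists x.
have : root (poly_pt v0 (\prod_i Q i)) c.
  apply: clos => x; have [i _ Yx] : (\bigcup_i Ys i) (pt x) by apply/cover/set_mem; exact: (valP x).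
  rewrite poly_pt_prod (bigD1 i) //= rootM; apply/orP; left.
  by have [_] := QP i; apply.
apply/negP; rewrite /root poly_pt_prod horner_prod; apply/prodf_neq0 => i _.
by have [] := QP i.
Qed.

End Global.

(** * The conductor *)

Section Conductor.
Variables (R : realType) (n : nat) (X : set 'rV[Cplx R]_n).
Variables (f : X -> Cplx R).
Notation C := (Cplx R).
Local Notation pt x := (set_val (x : X) : 'rV[C]_n).
Implicit Types (P Q : {poly cpoly R n}) (p s t : cpoly R n).

Definition value Q : X -> C := fun x => (poly_pt (pt x) Q).[f x].

Lemma valueM P Q x : value (P * Q) x = value P x * value Q x.
Proof. by rewrite /value poly_ptM hornerM. Qed.

Lemma valueD P Q x : value (P + Q) x = value P x + value Q x.
Proof. by rewrite /value /poly_pt rmorphD hornerD. Qed.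

Lemma valueB P Q x : value (P - Q) x = value P x - value Q x.
Proof. by rewrite /value /poly_pt rmorphB hornerD hornerN. Qed.

Lemma valueC p x : value p%:P x = peval p (pt x).
Proof. by rewrite /value /poly_pt map_polyC hornerC. Qed.

Lemma valueX x : value 'X x = f x.
Proof. by rewrite /value /poly_pt map_polyX hornerX. Qed.

Lemma value1 x : value 1 x = 1.
Proof. by rewrite -[1]/(1%:P) valueC peval1. Qed.

Lemma value0 x : value 0 x = 0.
Proof. by rewrite /value /poly_pt rmorph0 horner0. Qed.

Lemma valueXn Q k x : value (Q ^+ k) x = value Q x ^+ k.
Proof. by elim: k => [|k IH]; rewrite ?expr0 ?value1 // !exprS valueM IH. Qed.

Lemma value_sum (I : Type) (r : seq I) (F : I -> {poly cpoly R n}) x :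
  value (\sum_(i <- r) F i) x = \sum_(i <- r) value (F i) x.
Proof.
elim: r => [|i r IH]; first by rewrite !big_nil value0.
by rewrite !big_cons valueD IH.
Qed.

Lemma coordinate_ringD (g h : X -> C) :
  coordinate_ring X g -> coordinate_ring X h -> coordinate_ring X (g + h).
Proof. by move=> [p gp] [q hq]; exists (p + q) => x; rewrite pevalD -gp -hq. Qed.

Lemma adjoinE h : adjoin f h <-> exists Q, h = value Q.
Proof.
split.
  move=> h_adj; apply: (h_adj [set g | exists Q, g = value Q]); split; last first.
    move=> g [[p gp]|->]; last by exists 'X; apply: funext => x; rewrite valueX.
    by exists p%:P; apply: funext => x; rewrite valueC.
  split; rewrite /in_mem /=.
  - by apply/asboolP; exists 1; apply: funext => x; rewrite value1.
  - move=> _ _ /asboolP[P ->] /asboolP[Q ->]; apply/asboolP.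
    by exists (P - Q); apply: funext => x; rewrite valueB.
  - move=> _ _ /asboolP[P ->] /asboolP[Q ->]; apply/asboolP.
    by exists (P * Q); apply: funext => x; rewrite valueM.
move=> [Q ->] A [[A1 AB AM] sub].
have AD g h' : A g -> A h' -> A (g + h').
  move=> Ag Ah; have A0 : A 0 by rewrite -(subrr (1 : X -> C)); apply/set_mem/AB.
  have AN : A (- h') by rewrite -sub0r; apply/set_mem/AB; exact/mem_set.
  by rewrite -[h']opprK; apply/set_mem/AB; exact/mem_set.
have AMP g h' : A g -> A h' -> A (g * h').
  by move=> Ag Ah; apply/set_mem/AM; exact/mem_set.
elim/poly_ind: Q => [|Q p AQ].
  have -> : value 0 = value 0%:P by rewrite polyC0.
  by apply: sub; left; exists 0 => x; rewrite valueC.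
have -> : value (Q * 'X + p%:P) = value Q * f + value p%:P.
  by apply: funext => x; rewrite valueD valueM valueX.
apply: AD; last by apply: sub; left; exists p => x; rewrite valueC.
by apply: AMP => //; apply: sub; right.
Qed.

(** The preimage of the conductor in A[T] under T |-> f, where the Nullstellensatz
    applies. *)
Definition conductor_poly Q := forall P, coordinate_ring X (value (Q * P)).

Lemma conductor_polyE Q : conductor_poly Q <-> conductor f (value Q).
Proof.
split=> [JQ|[_ cQ] P].
  split; first by have := JQ 1; rewrite mulr1.
  move=> h /adjoinE[P ->]; have := JQ P; congr (coordinate_ring X _).
  by apply: funext => x; rewrite valueM.
have := cQ (value P) ((adjoinE _).2 (ex_intro _ P erefl)); congr (coordinate_ring X _).
by apply: funext => x; rewrite valueM.
Qed.

Lemma conductor_poly_ideal : ideal conductor_poly.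
Proof.
split.
- by move=> P; exists 0 => x; rewrite mul0r value0 peval0.
- move=> P Q JP JQ H; rewrite mulrDl.
  have -> : value (P * H + Q * H) = value (P * H) + value (Q * H).
    by apply: funext => x; rewrite valueD.
  exact: coordinate_ringD.
- by move=> P Q JQ H; rewrite [P * Q]mulrC -mulrA; apply: JQ.
Qed.

(** H = Q^k P at the largest k such that Q^k is not in the conductor. *)
Lemma square_in_conductor Q k : conductor_poly (Q ^+ k) -> ~ coordinate_ring X (value Q) ->
  exists2 H, ~ coordinate_ring X (value H) & forall m, (2 <= m)%N -> conductor_poly (H ^+ m).
Proof.
have [J0 JD JM] := conductor_poly_ideal.
elim: k => [|k IHk] JQ nQ.
  by case: nQ; have := JQ Q; rewrite expr0 mul1r.
have [JQk|nJQk] := pselect (conductor_poly (Q ^+ k)); first exact: IHk.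
have [P nP] : exists P, ~ coordinate_ring X (value (Q ^+ k * P)).
  apply: contrapT => noP; apply: nJQk => P; apply: contrapT => nP.
  by apply: noP; exists P.
exists (Q ^+ k * P); [exact: nP | move=> m m2].
case: k {IHk nJQk} => [|k] in JQ nP *.
  by case: nQ; have := JQ 1; rewrite mulr1.
have le_km : (k.+2 <= k.+1 * m)%N.
  apply: leq_trans (_ : (k.+1 * 2 <= _)%N); last by rewrite leq_mul2l m2 orbT.
  by rewrite muln2 -addnn addSn ltnS leq_addl.
by rewrite exprMn -exprM mulrC -(subnK le_km) exprD mulrA; apply: JM.
Qed.

(** A homomorphism from A[T] to the constants killing the conductor kills the
    relations of f, so it is a point of the closed graph. *)
Lemma conductor_nullstellensatz Q : zariski_closed X -> K0 X f ->
  (forall k, ~ conductor_poly (Q ^+ k)) ->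
  exists x : X, (forall P, conductor_poly P -> value P x = 0) /\ value Q x != 0.
Proof.
move=> X_closed f_K0 JQ.
pose iota : {rmorphism C -> {poly cpoly R n}} := polyC \o @mpolyC n C.
pose bs : seq {poly cpoly R n} := 'X :: [seq (mpolyX C (mnm1 i))%:P | i <- enum 'I_n].
pose S0 := image iota; have sS0 : subring S0 := image_subring iota.
have sS : subring (adjoin_seq S0 bs) := adjoin_seq_subring bs sS0.
have gen P : adjoin_seq S0 bs P.
  rewrite -[P]coefK poly_def; apply: subring_sum => // i _.
  have [_ _ SM] := sS; rewrite -mul_polyC; apply: SM; last first.
    by apply: subring_exp => //; apply: adjoin_seq_gen => //; rewrite inE eqxx.
  rewrite -[P`_i]mmap_id -[_%:P]/((polyC : {rmorphism _ -> _}) _) rmorph_mmap.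
  apply: mmap_subring => // [c|j]; first by apply: sub_adjoin_seq => //; exists c.
  by apply: adjoin_seq_gen => //; rewrite inE map_f ?orbT // mem_enum.
have [chi [chiC chiJ chiQ]] := nullstellensatz gen conductor_poly_ideal JQ.
pose v0 : 'rV[C]_n := \row_i chi (mpolyX C (mnm1 i))%:P.
have chiE P : chi P = (poly_pt v0 P).[chi 'X].
  rewrite -[P in LHS]coefK poly_def rmorph_sum (@horner_coef_wide _ (size P)); last exact: size_poly.
  apply: eq_bigr => i _; rewrite -mul_polyC rmorphM rmorphXn /poly_pt coef_map; congr (_ * _).
  rewrite -[in LHS](mmap_id P`_i) -[chi _]/((chi \o polyC) _) rmorph_mmap.
  apply: eq_mmap => [c|j] /=; first exact: chiC.
  by rewrite mxE.
have [|x xv fx] := @graph_closed _ _ _ X_closed _ f_K0 v0 (chi 'X).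
  move=> P Pf; apply/rootP; rewrite -chiE; apply: chiJ => H; exists 0 => x.
  by rewrite valueM peval0 [value P x](rootP (Pf x)) mul0r.
have valE P : value P x = chi P by rewrite chiE -xv -fx.
by exists x; split=> [P JP|]; rewrite valE //; apply: chiJ.
Qed.

Definition relation_on (Z : X -> Prop) Q := forall x, Z x -> value Q x = 0.

Definition nonzero_on (Z : X -> Prop) p := exists2 x, Z x & peval p (pt x) != 0.

(** The leading coefficient of a shorter relation vanishes on Z by minimality; removing
    the leading term leaves a relation on Z, and one descends on the degree. *)
Lemma minimal_relation_reduced Z P :
  (forall Q, relation_on Z Q -> nonzero_on Z (lead_coef Q) -> (size P <= size Q)%N) ->
  forall H, relation_on Z H -> (size H < size P)%N ->
  forall i x, Z x -> peval H`_i (pt x) = 0.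
Proof.
move=> Pmin H; elim/ltn_ind: {H}(size H) {-2}H (leqnn (size H)) => k IHk H le_Hk HZ lt_HP.
have leadZ x : Z x -> peval (lead_coef H) (pt x) = 0.
  move=> Zx; apply/eqP/negP => /negP Hx; move: lt_HP; rewrite ltnNge => /negP; apply.
  by apply: Pmin => //; exists x.
have [->|H0] := eqVneq H 0; first by move=> i x _; rewrite coef0 peval0.
have sH : (0 < size H)%N by rewrite size_poly_gt0.
pose H' := H - (lead_coef H)%:P * 'X^((size H).-1).
have lt_H' : (size H' < size H)%N.
  rewrite -[ltnRHS](prednK sH) ltnS; apply/leq_sizeP => i.
  rewrite leq_eqVlt => /predU1P[<-|lt_i]; rewrite coefB coefCM coefXn.
    by rewrite eqxx mulr1 lead_coefE subrr.
  rewrite gtn_eqF // mulr0 subr0 nth_default //.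
  by rewrite -(prednK sH).
have H'Z : relation_on Z H'.
  by move=> x Zx; rewrite valueB valueM valueC leadZ // mul0r HZ // subr0.
move=> i x Zx.
have := IHk _ (leq_trans lt_H' le_Hk) H' (leqnn _) H'Z (ltn_trans lt_H' lt_HP) i x Zx.
rewrite /H' coefB coefCM coefXn -mulN1r pevalD !pevalM leadZ // mul0r mulr0 addr0.
by [].
Qed.

Lemma single_root_poly (p : {poly C}) c : (1 < size p)%N ->
  (forall z, root p z -> z = c) -> p`_(size p).-2 = - (lead_coef p * c) *+ (size p).-1.
Proof.
move=> p_gt1 pc; have [s pE] := closed_field_poly_normal p.
have p0 : p != 0 by rewrite -size_poly_gt0; apply: leq_trans p_gt1.
have l0 : lead_coef p != 0 by rewrite lead_coef_eq0.
have sz : size p = (size s).+1 by rewrite pE size_scale // size_prod_XsubC.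
have sc : s = nseq (size s) c.
  apply/all_pred1P/allP => z zs; apply/eqP/pc.
  by rewrite pE rootZ // root_prod_XsubC.
rewrite {1}pE coefZ sz /=.
have s0 : size s != 0%N by rewrite -lt0n -ltnS -sz.
have sumE : \sum_(z <- s) z = c *+ size s by rewrite {1}sc big_nseq iter_addr_0.
by rewrite (coefPn_prod_XsubC s0) sumE mulrN mulrnAr mulNrn.
Qed.

(** The relation P of least degree among those with leading coefficient not
    identically zero on Z specializes, where this coefficient is not 0, to a
    multiple of (T - f(x))^d.  The set Z is arbitrary because closedness
    is only used for the whole graph. *)
Theorem rational_on_subset (Z : X -> Prop) (x0 : X) : zariski_closed X -> K0 X f -> Z x0 ->
  exists s t, nonzero_on Z s /\ forall x, Z x -> peval s (pt x) * f x = peval t (pt x).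
Proof.
move=> X_closed f_K0 Zx0.
have [G G_mon Gf] := integral_over_ring X_closed f_K0.
have valG x : value G x = 0 by apply/rootP/Gf.
pose good Q := relation_on Z Q /\ nonzero_on Z (lead_coef Q).
have ex : exists k, `[< exists2 Q, good Q & size Q = k >].
  exists (size G); apply/asboolP; exists G => //; split; first by move=> x _.
  by exists x0 => //; rewrite (monicP G_mon) peval1 oner_neq0.
case: (ex_minnP ex) => m /asboolP[P [PZ s0_nz] <-] Pmin.
have low := @minimal_relation_reduced Z P
  (fun Q QZ Q_nz => Pmin _ (asboolT (ex_intro2 _ _ Q (conj QZ Q_nz) erefl))).
have [x1 Zx1 x1P] := s0_nz; set s0 := lead_coef P in x1P.
have P0 : P != 0 by apply: contraNneq x1P => P0; rewrite /s0 P0 lead_coef0 peval0.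
have P_roots x : Z x -> peval s0 (pt x) != 0 -> forall c, root (poly_pt (pt x) P) c -> c = f x.
  move=> Zx sx c /rootP Pc.
  have [|x' xx' <-] := @graph_closed _ _ _ X_closed _ f_K0 (pt x) c; last first.
    by congr f; apply: val_inj.
  move=> Q Qf; apply/rootP.
  have trueS : subring (fun _ : cpoly R n => True) by [].
  have [k [M [H [_ _ lt_H eqH]]]] :=
    @pseudo_division _ _ P Q trueS (fun _ => I) (fun _ => I) P0.
  have HZ : relation_on Z H.
    move=> y Zy; have := congr1 (value ^~ y) eqH; rewrite -mul_polyC.
    by rewrite valueD !valueM PZ // [value Q y](rootP (Qf y)) !mulr0 add0r.
  have Hx : poly_pt (pt x) H = 0.
    by apply/polyP => i; rewrite coef_map coef0; exact: low HZ lt_H i x Zx.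
  have lead_k : (poly_pt (pt x) (s0 ^+ k)%:P).[c] = peval s0 (pt x) ^+ k.
    by rewrite /poly_pt map_polyC hornerC; exact: rmorphXn.
  have : peval s0 (pt x) ^+ k * (poly_pt (pt x) Q).[c] = 0.
    rewrite -lead_k -hornerM -poly_ptM mul_polyC eqH poly_ptD Hx addr0.
    by rewrite poly_ptM hornerM Pc mulr0.
  by move/eqP; rewrite mulf_eq0 expf_eq0 (negPf sx) andbF => /eqP.
have P_gt1 : (1 < size P)%N.
  rewrite ltnNge; apply/negP => /size1_polyC PC.
  have := PZ x1 Zx1; rewrite PC valueC => /eqP; apply/negP.
  by move: x1P; rewrite /s0 PC lead_coefC coefC eqxx.
pose s1 := P`_(size P).-2; pose d := (size P).-1.
have d0 : (d%:R : C) != 0.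
  by rewrite pnatr_eq0 /d; case: (size P) P_gt1 => [|[]].
have pevalMn p : peval (p *+ d) =1 (fun v => peval p v *+ d) by move=> v; apply: mevalMn.
(* The extra factor s0 makes the identity hold where s0 vanishes. *)
exists (s0 * s0 *+ d), (- (s0 * s1)); split.
  by exists x1 => //; rewrite pevalMn pevalM -mulr_natr !mulf_neq0.
move=> x Zx; rewrite pevalMn -mulN1r !pevalM.
have [->|sx] := eqVneq (peval s0 (pt x)) 0; first by rewrite !(mul0r, mul0rn, mulr0).
have szPx : size (poly_pt (pt x) P) = size P by rewrite size_map_poly_id0.
have leadPx : lead_coef (poly_pt (pt x) P) = peval s0 (pt x) by rewrite lead_coef_map_eq.
have := @single_root_poly (poly_pt (pt x) P) (f x).
rewrite szPx leadPx => /(_ P_gt1 (P_roots x Zx sx)).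
have -> : (poly_pt (pt x) P)`_(size P).-2 = peval s1 (pt x) by rewrite coef_map.
rewrite -/d => ->.
have -> : peval (-1) (pt x) = -1 :> C by rewrite /peval mevalN meval1.
by rewrite mulN1r mulNrn mulrN opprK mulrnAr mulrnAl mulrA.
Qed.

(** Modulo a monic equation G of f, elements of B are combinations of the f^i with
    i < D, and s^D f^i agrees on Z with s^(D - i) t^i, which is in A. *)
Lemma conductor_of_rational (Z : X -> Prop) s t : zariski_closed X -> K0 X f ->
  (forall Q, relation_on Z Q -> conductor_poly Q) ->
  (forall x, Z x -> peval s (pt x) * f x = peval t (pt x)) ->
  exists D, conductor_poly (s ^+ D)%:P.
Proof.
move=> X_closed f_K0 JZ st.
have [G G_mon Gf] := integral_over_ring X_closed f_K0.
have valG x : value G x = 0 by apply/rootP/Gf.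
pose D := (size G).-1; exists D => H.
have sG : (0 < size G)%N by rewrite size_poly_gt0 monic_neq0.
have HE := Pdiv.RingMonic.rdivp_eq G_mon H.
set M := Pdiv.CommonRing.rdivp _ _ in HE; set N := Pdiv.CommonRing.rmodp _ _ in HE.
have szN : (size N <= D)%N.
  by rewrite -ltnS /D prednK // Pdiv.CommonRing.ltn_rmodp monic_neq0.
pose W := \sum_(i < D) (N`_i)%:P * ((s ^+ D)%:P * 'X^i - (s ^+ (D - i) * t ^+ i)%:P).
have valW x : value W x = \sum_(i < D) peval N`_i (pt x) *
    (peval s (pt x) ^+ D * f x ^+ i - peval s (pt x) ^+ (D - i) * peval t (pt x) ^+ i).
  rewrite value_sum; apply: eq_bigr => i _.
  rewrite valueM valueB valueM valueXn valueX !valueC pevalM.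
  by rewrite /peval !rmorphXn.
have WZ : relation_on Z W.
  move=> x Zx; rewrite valW big1 // => i _; rewrite -st // exprMn mulrA -exprD subnK ?subrr ?mulr0 //.
  exact: ltnW.
have [w wE] := JZ W WZ 1; rewrite mulr1 in wE.
exists (w + \sum_(i < D) N`_i * (s ^+ (D - i) * t ^+ i)) => x.
rewrite pevalD -wE valW HE valueM valueD valueM valG mulr0 add0r valueC.
have -> : value N x = \sum_(i < D) peval N`_i (pt x) * f x ^+ i.
  rewrite /value (@horner_coef_wide _ D); last exact: leq_trans (size_poly _ _) szN.
  by apply: eq_bigr => i _; rewrite /poly_pt coef_map.
have -> : peval (\sum_(i < D) N`_i * (s ^+ (D - i) * t ^+ i)) (pt x) =
    \sum_(i < D) peval N`_i (pt x) * (peval s (pt x) ^+ (D - i) * peval t (pt x) ^+ i).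
  rewrite /peval -[LHS]/((meval (fun i => pt x ord0 i) : {rmorphism _ -> _}) _) rmorph_sum.
  by apply: eq_bigr => i _; rewrite !rmorphM !rmorphXn.
have -> : peval (s ^+ D) (pt x) = peval s (pt x) ^+ D :> C by rewrite /peval rmorphXn.
rewrite mulr_sumr -big_split /=; apply: eq_bigr => i _; ring.
Qed.

Theorem radical_conductor_trivial : zariski_closed X -> K0 X f ->
  (forall Q k, conductor_poly (Q ^+ k) -> conductor_poly Q) -> coordinate_ring X f.
Proof.
move=> X_closed f_K0 Jrad.
pose Z (x : X) := forall P, conductor_poly P -> value P x = 0.
have JZ Q : relation_on Z Q -> conductor_poly Q.
  move=> QZ; apply: contrapT => nQ.
  have [k|x [Zx /eqP]] := @conductor_nullstellensatz Q X_closed f_K0; first by move=> /Jrad.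
  by apply; apply: QZ.
(* If Z is empty, 1 is in the conductor and f is in A. *)
have [[x0 Zx0]|noZ] := pselect (exists x, Z x); last first.
  have := JZ 1 (fun x Zx => False_ind _ (noZ (ex_intro _ x Zx))) 'X; rewrite mul1r.
  by congr (coordinate_ring X _); apply: funext => x; rewrite valueX.
have [s [t [[x1 Zx1 s1] st]]] := rational_on_subset X_closed f_K0 Zx0.
have [D JD] := conductor_of_rational X_closed f_K0 JZ st.
have := Zx1 _ JD; rewrite valueC /peval rmorphXn => /eqP.
by rewrite expf_eq0 => /andP[_]; rewrite (negPf s1).
Qed.

End Conductor.

Theorem proposition5p2 (R : realType) (n : nat) (X : set 'rV[Cplx R]_n)
    (X_closed : zariski_closed X) (f : X -> Cplx R)
    (f_K0 : (K0 X `\` coordinate_ring X) f) :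
  exists g : X -> Cplx R,
    [/\ (adjoin f `\` coordinate_ring X) g,
        forall m : nat, (2 <= m)%N -> conductor f (g ^+ m)
      & conductor f `<=` coordinate_ring X].
Proof.
have [fK f_nA] := f_K0.
have [[Q [k [Qk nQ]]]|norad] := pselect (exists Q k, conductor_poly f (Q ^+ k) /\
    ~ coordinate_ring X (value f Q)); last first.
  case: f_nA; apply: (radical_conductor_trivial X_closed fK) => Q k Qk P.
  apply: contrapT => nQP; apply: norad; exists (Q * P), k; split=> //.
  by rewrite exprMn mulrC; have [_ _ JM] := conductor_poly_ideal f; apply: JM.
have [H nH JH] := square_in_conductor Qk nQ.
exists (value f H); split; last by move=> h [].
  by split=> //; apply/adjoinE; exists H.
move=> m m2; suff -> : value f H ^+ m = value f (H ^+ m) by apply/conductor_polyE/JH.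
elim: m {m2} => [|m IH]; first by apply: funext => x; rewrite !expr0 value1.
by rewrite !exprS IH; apply: funext => x; rewrite valueM.
Qed.
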